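(* Let $A\in\mathbb{R}^{n\times d}$, $b\in\mathbb{R}^n$, $f(x)=\|Ax-b\|_2^2$, and let $\Phi\in\mathbb{R}^{m\times n}$ be the SJLT with column sparsity $s$. Let $x_*$ be a minimizer of $f$ over $\mathbb{R}^d$ and $\hat x$ a minimizer of $x\mapsto\|\Phi Ax-\Phi b\|_2^2$ over $\mathbb{R}^d$. Let $r(A)$ be the rank of $A$ and $\mu(A)=\max_{1\le j\le n}\|P_{\mathrm{Col}(A)}e_j\|_2$, where $P_{\mathrm{Col}(A)}$ is the orthogonal projection onto the column space of $A$. Let $\varepsilon\in(0,1/2)$, $\eta\le 1/m$, and suppose $$m\gtrsim\varepsilon^{-1}\big((\log\eta^{-1})(r(A)+\log m)(\log m)^2+(\log\eta^{-1})^2r(A)\big),$$ $$s\gtrsim\varepsilon^{-1}\mu(A)^2\big((\log\eta^{-1})^2+(\log\eta^{-1})(\log m)^3\big)+\varepsilon^{-1/2}\mu(A)\big((\log\eta^{-1})^{3/2}+(\log\eta^{-1})(\log m)^{3/2}\big).$$ Then with probability at least $1-\eta$, $f(\hat x)\le(1-\varepsilon)^{-2}f(x_* )$.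
   Context: $\gtrsim$ means $\ge$ up to a universal constant factor. SJLT with column sparsity $s$: $\Phi_{ij}=s^{-1/2}\sigma_{ij}\delta_{ij}$ with $(\sigma_{ij})$ independent Rademachers, $(\delta_{ij})\in\{0,1\}$ independent of $\sigma$, each column has exactly $s$ ones, for fixed $j$ and distinct $i_1,\dots,i_k$: $\mathbb{E}\prod_t\delta_{i_tj}\le(s/m)^k$, and the columns $(\delta_{ij})_i$ are independent across $j$.
   Formalization: The formal statement assumes m ≥ 2 (and η > 0, s ≥ 1, implicit in log(1/η) and s^{-1/2}); for m = 1 the claim fails, e.g. m = s = 1, A = e_1, b = e_2, ε = 1/4 and η slightly below 1, where f(x̂) = 2 > 16/9 always. *)

(* Defs.v *)
From HB Require Import structures.
From mathcomp Require Import all_boot all_order all_algebra.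
From mathcomp Require Import all_classical all_reals all_analysis.

Set Implicit Arguments.
Unset Strict Implicit.
Unset Printing Implicit Defensive.

Import Order.TTheory GRing.Theory Num.Theory.
Import numFieldNormedType.Exports.

Local Open Scope classical_set_scope.
Local Open Scope ring_scope.

Section LeastSquares.
Variable R : realType.

(* The library norm on matrices is the sup norm, hence this definition. *)
Definition norm2 (p q : nat) (v : 'M[R]_(p, q)) : R :=
  Num.sqrt (\sum_i \sum_j v i j ^+ 2).

Definition lsq (n d : nat) (A : 'M[R]_(n, d)) (b : 'cV[R]_n) (x : 'cV[R]_d) : R :=
  norm2 (A *m x - b) ^+ 2.

Definition minimizer (d : nat) (f : 'cV[R]_d -> R) (x : 'cV[R]_d) : Prop :=
  forall y, f x <= f y.

(* Projection onto Col(A) along its orthogonal complement, acting on row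
   vectors from the right: Col(A) is the row space of A^T, and the row space
   of kermx A is {u | u *m A = 0}, the orthogonal complement of Col(A).
   This is the real counterpart of spectral.proj_ortho. *)
Definition col_proj (n d : nat) (A : 'M[R]_(n, d)) : 'M[R]_n :=
  proj_mx <<A^T>>%MS (kermx A).

Definition coherence (n d : nat) (A : 'M[R]_(n, d)) : R :=
  \big[Num.max/0]_(j < n) norm2 (delta_mx (0 : 'I_1) j *m col_proj A).

End LeastSquares.

Section Independence.
Context {d : measure_display} {T : measurableType d} {R : realType}.
Variable P : probability T R.

Definition sigma_generated {I : Type} (X : I -> {RV P >-> R}) : set (set T) :=
  <<s \bigcup_(i in [set: I]) preimage_set_system setT (X i) measurable >>.

Definition independent_systems {J : finType} (F : J -> set (set T)) : Prop :=
  forall (K : {set J}) (E : J -> set T), (forall j, j \in K -> F j (E j)) ->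
    P (\bigcap_(j in [set j | j \in K]) E j) = (\prod_(j in K) P (E j))%E.

Definition independent_RVs {J : finType} (X : J -> {RV P >-> R}) : Prop :=
  independent_systems (fun j => sigma_generated (fun _ : unit => X j)).

Definition independent_pair (F G : set (set T)) : Prop :=
  forall E E', F E -> G E' -> P (E `&` E') = (P E * P E')%E.

(* The values are +-1 everywhere rather than almost everywhere; together with
   the pointwise conditions in sjlt_variables below this makes an SJLT take
   finitely many values, so that every event defined from it is measurable. *)
Definition rademacher (X : {RV P >-> R}) : Prop :=
  [/\ forall w, X w = 1 \/ X w = -1,
      P (X @^-1` [set 1]) = (2^-1 : R)%:E
    & P (X @^-1` [set -1]) = (2^-1 : R)%:E].

End Independence.

Section SJLT.
Context {d : measure_display} {T : measurableType d} {R : realType}.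
Variables (P : probability T R) (m n s : nat).

(* In delta_moment, the set I ranges over the tuples of distinct i_1, ..., i_k
   (as unordered families, the product being commutative), with k = #|I|. *)
Record sjlt_variables (sigma delta : 'I_m -> 'I_n -> {RV P >-> R}) : Prop := {
  sigma_rademacher : forall i j, rademacher (sigma i j);
  sigma_independent :
    independent_RVs (fun ij : 'I_m * 'I_n => sigma ij.1 ij.2);
  delta_01 : forall i j w, delta i j w = 0 \/ delta i j w = 1;
  delta_sigma_independent : independent_pair P
    (sigma_generated (fun ij : 'I_m * 'I_n => delta ij.1 ij.2))
    (sigma_generated (fun ij : 'I_m * 'I_n => sigma ij.1 ij.2));
  delta_column_sum : forall j w, \sum_i delta i j w = s%:R;
  delta_moment : forall (j : 'I_n) (I : {set 'I_m}),
    ('E_P[fun w => (\prod_(i in I) delta i j w)%R]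
       <= ((s%:R / m%:R) ^+ #|I|)%:E)%E;
  delta_columns_independent :
    independent_systems P (fun j => sigma_generated (fun i => delta i j))
}.

Definition is_sjlt (Phi : T -> 'M[R]_(m, n)) : Prop :=
  exists sigma delta : 'I_m -> 'I_n -> {RV P >-> R},
    sjlt_variables sigma delta /\
    forall w i j,
      Phi w i j = (Num.sqrt s%:R)^-1 * sigma i j w * delta i j w.

End SJLT.

(* Main.v *)
(**
Write L = ln (1/eta), let U be an orthonormal basis of Col(A) with rows u_j
(so |u_j| <= mu), and let z = b - A xstar, so that U^T z = 0.  If
U^T Phi^T Phi U >= 1/4 and |U^T Phi^T Phi z|^2 <= (eps/8) |z|^2, the normal
equations of the sketched problem give A xhat = A xstar + U v with
|v|^2 <= 2 eps |z|^2, and f(xhat) = |z|^2 + |v|^2.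

Lower bound.  Given the supports delta, the rows y_i of Phi U are independent
and the second moments of the y_i y_i^T sum to the identity, since every column
of delta has s ones.  A Chernoff bound over the columns shows that, for all i,
E |y_i|^2 = (1/s) sum_j delta_ij |u_j|^2 is at most c/L.  As only a lower
bound is needed, a row with |y_i|^2 > c'/L may be discarded; fourth moments show that
this costs little variance.  For the remaining rows matrix Chernoff is proved
with the potential F(Q) = tr Q^(-p), p ~ L: replacing y y^T by half its mean
does not decrease E F(Q + y y^T).  The rank-one downdate formula and the
trace inequality p tr(Y^(p-1) X) <= tr X^p + (p-1) tr Y^p give
F(Q + y y^T) <= F(Q) - (p/2) y^T Q^(-p-1) y, and convexity of F gives the rest.

Cross term.  Given delta, U^T Phi^T Phi z is a vector-valued Rademacher chaos of
order two without diagonal (U^T z = 0 and the column sums of delta cancel it),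
so Bonami's lemma bounds its 2q-th moment, q ~ L, by its variance
(2/s^2) sum_k z_k^2 T_k with T_k = sum_(j <> k) |u_j|^2 #(supp_j & supp_k).
Jensen and exponential moments over the columns give
|T_k|_q <= C (q mu^2 + s^2 r/m), hence |cross|^2 <= C L^2 (r/m + L mu^2/s^2) |z|^2.
*)

Require Import Defs.
From HB Require Import structures.
From mathcomp Require Import all_boot all_order all_algebra.
From mathcomp Require Import all_classical all_reals all_analysis.
From mathcomp Require Import complex ring lra.

Set Implicit Arguments.
Unset Strict Implicit.
Unset Printing Implicit Defensive.

Import Order.TTheory GRing.Theory Num.Theory.
Import numFieldNormedType.Exports.

Local Open Scope ring_scope.

(** * Spectral theorem for real symmetric matrices *)

Section RealSpectral.
Variable R : rcfType.

(** Over the complex numbers the matrix is Hermitian, so its spectral diagonal is real. Such an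
    eigenvalue is a root of the real characteristic polynomial and hence has a real eigenvector,
    which is then normalised. *)
Lemma sym_eigenvector n (A : 'M[R]_n.+1) : A^T = A ->
  exists2 u : 'rV[R]_n.+1, u *m u^T = 1%:M & exists l, u *m A = l *: u.
Proof.
move=> As.
pose AC := map_mx (real_complex R) A.
have ACh : AC \is hermsymmx.
  apply: realsym_hermsym.
    apply/is_hermitianmxP; rewrite expr0 scale1r map_mx_id //.
    by rewrite /AC map_trmx As.
  apply/mxOverP => i j; rewrite mxE; apply/complex_realP; by exists (A i j).
have /hermitian_normalmx/orthomx_spectralP ACE := ACh.
have /mxOverP/(_ 0 0)/complex_realP[l lE] := hermitian_spectral_diag_real ACh.
have : eigenvalue AC (real_complex R l).
  apply/eigenvalueP; exists (row 0 (spectralmx AC)).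
    rewrite [in X in _ *m X]ACE -row_mul !mulmxA mulmxV ?spectral_unit // mul1mx.
    by rewrite row_mul row_diag_mx -scalemxAl -rowE lE.
  apply/eqP => r0; have := unitarymxP (spectral_unitarymx AC).
  move=> /matrixP/(_ 0 0); rewrite !mxE eqxx => /eqP.
  rewrite big1 ?(eq_sym 0) ?oner_eq0 // => i _.
  by have /rowP/(_ i) := r0; rewrite !mxE => ->; rewrite mul0r.
rewrite eigenvalue_root_char -map_char_poly fmorph_root -eigenvalue_root_char.
move=> /eigenvalueP[v vA v0].
have vv : 0 < (v *m v^T) 0 0.
  rewrite mxE; under eq_bigr do rewrite mxE -expr2.
  rewrite lt_def sumr_ge0 ?andbT => [|i _]; last exact: sqr_ge0.
  apply: contra v0 => /eqP/psumr_eq0P v0; apply/eqP/rowP => i; rewrite mxE.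
  by apply/eqP; rewrite -sqrf_eq0 v0 // => ? _; exact: sqr_ge0.
pose c := (Num.sqrt ((v *m v^T) 0 0))^-1.
have c2 : c * (c * (v *m v^T) 0 0) = 1.
  by rewrite /c mulrA -invfM -expr2 sqr_sqrtr ?ltW // mulVf ?gt_eqF.
exists (c *: v).
  rewrite [LHS]mx11_scalar linearZ /= -scalemxAr -scalemxAl scalerA.
  by rewrite mxE -mulrA c2.
by exists l; rewrite -scalemxAl vA scalerA mulrC -scalerA.
Qed.

(** The Householder reflection along [e - u] exchanges the unit vectors [e] and [u], so its first
    row is [u]. For [u = e] that direction is zero and the identity serves. *)
Lemma orthogonal_with_first_row n (u : 'rV[R]_n.+1) : u *m u^T = 1%:M ->
  exists2 H : 'M[R]_n.+1, H *m H^T = 1%:M & row 0 H = u.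
Proof.
move=> u1; pose e : 'rV[R]_n.+1 := delta_mx 0 0.
have [->|eu] := eqVneq u e.
  exists 1%:M; first by rewrite trmx1 mulmx1.
  by rewrite rowE mulmx1.
pose w := e - u; pose a := (w *m w^T) 0 0.
have ee : e *m e^T = 1%:M.
  by rewrite /e trmx_delta mul_delta_mx; apply/matrixP => i j; rewrite !ord1 !mxE.
have ew : a = 2 * (e *m w^T) 0 0.
  rewrite /a /w linearB /= mulmxBl !mulmxBr ee u1 !mxE.
  have -> : \sum_j u 0 j * e^T j 0 = \sum_j e 0 j * u^T j 0.
    by apply: eq_bigr => j _; rewrite !mxE mulrC.
  by rewrite !eqxx /=; ring.
have a0 : a != 0.
  apply/eqP => a0; move: eu; rewrite eq_sym -subr_eq0 => /eqP; apply.
  apply/rowP => i; rewrite [RHS]mxE; apply/eqP; rewrite -sqrf_eq0.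
  move: a0; rewrite /a mxE; under eq_bigr do rewrite [w^T _ _]mxE -expr2.
  by move=> /psumr_eq0P -> // ? _; exact: sqr_ge0.
have wa : w *m w^T = a%:M by rewrite [LHS]mx11_scalar.
have wu : e - w = u by rewrite subKr.
clearbody a w.
pose H := 1%:M - (2 / a) *: (w^T *m w).
have Ht : H^T = H by rewrite linearB linearZ /= trmx1 trmx_mul trmxK.
exists H.
  rewrite Ht /H mulmxBl mul1mx mulmxBr mulmx1 -scalemxAl -scalemxAr.
  rewrite mulmxA -(mulmxA w^T w w^T) wa.
  rewrite mul_mx_scalar -scalemxAl !scalerA.
  have -> : 2 / a * (2 / a * a) = 2 / a + 2 / a by field.
  by rewrite scalerDl opprB addrK subrK.
rewrite rowE -/e /H mulmxBr mulmx1 -scalemxAr mulmxA [e *m w^T]mx11_scalar.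
rewrite mul_scalar_mx scalerA ew.
have -> : 2 / (2 * (e *m w^T) 0 0) * (e *m w^T) 0 0 = 1.
  have : (e *m w^T) 0 0 != 0 by apply: contraNneq a0; rewrite ew => ->; rewrite mulr0.
  by move=> ?; field.
by rewrite scale1r.
Qed.

(** Deflation: in an orthonormal basis starting with a unit eigenvector the first row is a multiple
    of the first basis vector, symmetry clears the first column too, and induction handles the
    remaining block. *)
Theorem sym_spectral n (A : 'M[R]_n) : A^T = A ->
  exists (Z : 'M[R]_n) (l : 'rV[R]_n), Z *m Z^T = 1%:M /\ A = Z^T *m diag_mx l *m Z.
Proof.
elim: n A => [|n IH] A As.
  by exists 1%:M, 0; split; apply/matrixP => -[].
have [u u1 [l ul]] := sym_eigenvector As.
have [H HH rH] := orthogonal_with_first_row u1.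
have HtH : H^T *m H = 1%:M by rewrite mulmx1C.
pose B : 'M[R]_(1 + n) := H *m A *m H^T.
have Bs : B^T = B by rewrite /B !trmx_mul trmxK As mulmxA.
have r0 : row 0 B = l *: delta_mx 0 0.
  rewrite /B row_mul row_mul rH ul -scalemxAl; congr (_ *: _).
  by rewrite -rH -row_mul HH rowE mulmx1.
pose B' : 'M[R]_n := drsubmx B.
have l0 (i : 'I_1) : lshift n i = (0 : 'I_n.+1) by apply: val_inj; rewrite /= ord1.
have Bur : ursubmx B = 0.
  apply/matrixP => i j; have /rowP/(_ (rshift 1 j)) := r0; rewrite [RHS]mxE !mxE l0.
  by move=> ->; rewrite mulr0.
have BE : B = block_mx l%:M 0 0 B'.
  rewrite -[LHS]submxK Bur; congr block_mx.
    apply/matrixP => i j; have /rowP/(_ (lshift n j)) := r0; rewrite !mxE !l0 !ord1.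
    by move=> ->; rewrite ?eqxx ?mulr1.
  by have := congr1 trmx Bur; rewrite trmx_ursub Bs trmx0.
have B's : B'^T = B' by rewrite /B' trmx_drsub Bs.
have [Z [d [ZZ B'E]]] := IH _ B's.
pose Z1 : 'M[R]_(1 + n) := block_mx 1%:M 0 0 Z.
have O1t : Z1^T = block_mx 1%:M 0 0 Z^T by rewrite /Z1 tr_block_mx trmx1 !trmx0.
have O1O1 : Z1 *m Z1^T = 1%:M.
  rewrite O1t /Z1 mulmx_block.
  by rewrite !mulmx0 !mul0mx !addr0 add0r mulmx1 ZZ -scalar_mx_block.
have O1B : Z1^T *m diag_mx (row_mx l%:M d) *m Z1 = B.
  rewrite BE diag_mx_row O1t /Z1 !mulmx_block !mulmx0 !mul0mx !addr0 !add0r B'E.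
  rewrite !mul1mx !mulmx1 ?mulmxA ?mulmx0 ?mul0mx; congr block_mx.
  by apply/matrixP => i j; rewrite !ord1 !mxE eqxx.
exists (Z1 *m H), (row_mx l%:M d); split.
  by rewrite trmx_mul mulmxA -(mulmxA Z1) HH mulmx1; exact: O1O1.
transitivity (H^T *m B *m H).
  by rewrite /B !mulmxA HtH mul1mx -mulmxA HtH mulmx1.
by rewrite -O1B trmx_mul !mulmxA.
Qed.

End RealSpectral.

(** * Trace inequalities *)

(** The inductive step adds [y] times the induction hypothesis to
    [(x - y) * (x ^+ p.+1 - y ^+ p.+1) >= 0], whose factors have the same sign. *)
Lemma young_nat (R : realDomainType) (p : nat) (x y : R) : 0 <= x -> 0 <= y ->
  p.+1%:R * (y ^+ p * x) <= x ^+ p.+1 + p%:R * y ^+ p.+1.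
Proof.
move=> x0 y0; elim: p => [|p IH]; first by rewrite !expr0 !mul1r mul0r addr0.
have key : 0 <= (x - y) * (x ^+ p.+1 - y ^+ p.+1).
  have [xy|/ltW yx] := leP x y.
    by rewrite mulr_le0 // subr_le0 // lerXn2r.
  by rewrite mulr_ge0 // subr_ge0 // lerXn2r.
have := ler_wpM2l y0 IH.
rewrite -!natr1 !exprS in key *; set a := x ^+ p in key *; set b := y ^+ p in key *.
set P := p%:R; nra.
Qed.

Section Potential.
Variable R : rcfType.

Definition qform n (X : 'M[R]_n) (x : 'cV[R]_n) : R := (x^T *m X *m x) 0 0.
Definition nsq n (x : 'cV[R]_n) : R := \sum_i x i 0 ^+ 2.

Lemma nsq_ge0 n (x : 'cV[R]_n) : 0 <= nsq x.
Proof. by apply: sumr_ge0 => i _; exact: sqr_ge0. Qed.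

Lemma nsqE n (x : 'cV[R]_n) : nsq x = (x^T *m x) 0 0.
Proof. by rewrite mxE; apply: eq_bigr => i _; rewrite mxE expr2. Qed.

Lemma qformD n (X Y : 'M[R]_n) x : qform (X + Y) x = qform X x + qform Y x.
Proof. by rewrite /qform mulmxDr mulmxDl mxE. Qed.

Lemma qformZ n (a : R) (X : 'M[R]_n) x : qform (a *: X) x = a * qform X x.
Proof. by rewrite /qform -scalemxAr -scalemxAl mxE. Qed.

Lemma qform_sum n (I : Type) (r : seq I) (P : pred I) (X : I -> 'M[R]_n) x :
  qform (\sum_(i <- r | P i) X i) x = \sum_(i <- r | P i) qform (X i) x.
Proof.
apply: (big_morph (fun X => qform X x) (fun X Y => qformD X Y x)).
by rewrite /qform mulmx0 mul0mx mxE.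
Qed.

Lemma qform1 n (x : 'cV[R]_n) : qform 1%:M x = nsq x.
Proof. by rewrite /qform mulmx1 nsqE. Qed.

Lemma qform_rank1 n (y x : 'cV[R]_n) :
  qform (y *m y^T) x = ((y^T *m x) 0 0) ^+ 2.
Proof.
rewrite /qform mulmxA -mulmxA -[x^T *m y]trmxK trmx_mul trmxK.
by rewrite mxE big_ord1 mxE expr2.
Qed.

Section Diagonalised.
Variables (n : nat) (Z : 'M[R]_n).
Hypothesis ZZ : Z *m Z^T = 1%:M.
Implicit Types a b : 'rV[R]_n.

(** Functional calculus: for orthogonal [Z] the rows of [Z] are eigenvectors with eigenvalues [a],
    and products, powers and inverses act on [a] entrywise. *)
Definition conjdiag a := Z^T *m diag_mx a *m Z.

Lemma nsq_orth (x : 'cV[R]_n) : nsq (Z *m x) = nsq x.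
Proof.
by rewrite !nsqE trmx_mul mulmxA -(mulmxA x^T) (mulmx1C ZZ) mulmx1.
Qed.

Lemma qform_conjdiag a x : qform (conjdiag a) x = \sum_i a 0 i * (Z *m x) i 0 ^+ 2.
Proof.
rewrite /qform /conjdiag !mulmxA -trmx_mul -mulmxA mxE.
by apply: eq_bigr => i _; rewrite mul_mx_diag mxE [_^T _ _]mxE; ring.
Qed.

Lemma tr_conjdiag a : \tr (conjdiag a) = \sum_i a 0 i.
Proof. by rewrite /conjdiag mxtrace_mulC mulmxA ZZ mul1mx mxtrace_diag. Qed.

Lemma conjdiagM a b : conjdiag a *m conjdiag b = conjdiag (\row_i (a 0 i * b 0 i)).
Proof.
rewrite /conjdiag -!mulmxA (mulmxA Z) ZZ mul1mx (mulmxA (diag_mx a)).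
by congr (_ *m (_ *m _)); apply/matrixP => i j; rewrite mul_diag_mx !mxE mulrnAr.
Qed.

Lemma conjdiag1 : conjdiag (const_mx 1) = 1%:M.
Proof. by rewrite /conjdiag diag_const_mx mulmx1 (mulmx1C ZZ). Qed.

Lemma conjdiagX a k : conjdiag a ^+ k = conjdiag (\row_i (a 0 i ^+ k)).
Proof.
elim: k => [|k IH].
  rewrite expr0 -[LHS]conjdiag1; congr conjdiag; apply/rowP => i.
  by rewrite !mxE expr0.
rewrite exprS IH -[LHS]/(_ *m _) conjdiagM; congr conjdiag; apply/rowP => i.
by rewrite !mxE exprS.
Qed.

Lemma conjdiag_sym a : (conjdiag a)^T = conjdiag a.
Proof. by rewrite /conjdiag !trmx_mul tr_diag_mx trmxK mulmxA. Qed.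

(** The test vector is the [i]-th eigenvector, [Z^T *m delta_mx i 0]. *)
Lemma diag_ge a c i : (forall x, c * nsq x <= qform (conjdiag a) x) -> c <= a 0 i.
Proof.
move=> /(_ (Z^T *m delta_mx i 0)).
rewrite qform_conjdiag -nsq_orth mulmxA ZZ mul1mx.
rewrite /nsq (bigD1 i) //= big1 => [|j ji]; last by rewrite mxE (negbTE ji) expr0n.
rewrite (bigD1 i) //= big1 => [|j ji]; last by rewrite mxE (negbTE ji) expr0n mulr0.
by rewrite mxE !eqxx expr1n !addr0 !mulr1.
Qed.

Lemma conjdiag_inv a : (forall i, a 0 i != 0) ->
  invmx (conjdiag a) = conjdiag (\row_i (a 0 i)^-1).
Proof.
move=> a0; have H : conjdiag a *m conjdiag (\row_i (a 0 i)^-1) = 1%:M.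
  rewrite conjdiagM -conjdiag1; congr conjdiag; apply/rowP => i.
  by rewrite !mxE mulfV.
have [U _] := mulmx1_unit H.
by rewrite -[RHS]mul1mx -(mulVmx U) -mulmxA H mulmx1.
Qed.

End Diagonalised.

Lemma tr_conjdiagM n (Z P : 'M[R]_n) (a b : 'rV[R]_n) :
  \tr (conjdiag Z a *m conjdiag P b) =
  \sum_i \sum_j a 0 i * b 0 j * ((Z *m P^T) i j) ^+ 2.
Proof.
rewrite /conjdiag -!mulmxA mxtrace_mulC -!mulmxA (mulmxA Z) /mxtrace.
have tC i j : (P *m Z^T) j i = (Z *m P^T) i j.
  by rewrite -[Z in RHS]trmxK -trmx_mul [RHS]mxE.
apply: eq_bigr => i _; rewrite mul_diag_mx mxE [X in _ * X]mxE mulr_sumr.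
apply: eq_bigr => j _; rewrite mul_diag_mx [X in _ * (_ * X)]mxE tC.
by ring.
Qed.

Lemma orth_double_sum n (Z P : 'M[R]_n) : Z *m Z^T = 1%:M -> P *m P^T = 1%:M ->
  (forall i, \sum_j ((Z *m P^T) i j) ^+ 2 = 1) *
  (forall j, \sum_i ((Z *m P^T) i j) ^+ 2 = 1).
Proof.
move=> ZZ PP; set C := Z *m P^T.
have CC : C *m C^T = 1%:M.
  by rewrite /C trmx_mul trmxK mulmxA -(mulmxA Z) (mulmx1C PP) mulmx1.
split=> i.
  have /matrixP/(_ i i) := CC; rewrite mxE [RHS]mxE eqxx mulr1n => <-.
  by apply: eq_bigr => j _; rewrite [C^T _ _]mxE expr2.
have /matrixP/(_ i i) := mulmx1C CC; rewrite mxE [RHS]mxE eqxx mulr1n => <-.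
by apply: eq_bigr => j _; rewrite [C^T _ _]mxE expr2.
Qed.

Definition psd n (X : 'M[R]_n) := X^T = X /\ forall x, 0 <= qform X x.

Lemma psd_spectral n (X : 'M[R]_n) : psd X ->
  exists (Z : 'M[R]_n) (l : 'rV[R]_n),
    [/\ Z *m Z^T = 1%:M, X = conjdiag Z l & forall i, 0 <= l 0 i].
Proof.
move=> [Xs X0]; have [Z [l [ZZ XE]]] := sym_spectral Xs.
exists Z, l; split=> // i; apply: (diag_ge ZZ) => x.
by rewrite mul0r; move: (X0 x); rewrite XE.
Qed.

Lemma psdX n (X : 'M[R]_n) k : psd X -> psd (X ^+ k).
Proof.
move=> /psd_spectral[Z [l [ZZ -> l0]]]; rewrite conjdiagX //; split.
  exact: conjdiag_sym.
move=> x; rewrite qform_conjdiag; apply: sumr_ge0 => i _.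
by rewrite mxE mulr_ge0 ?sqr_ge0 // exprn_ge0.
Qed.

(* Spectral decompositions reduce the trace inequality to the scalar one,
   averaged over the doubly stochastic matrix of squared overlaps. *)
Lemma trace_young n p (X Y : 'M[R]_n) : psd X -> psd Y ->
  p.+1%:R * \tr (Y ^+ p *m X) <= \tr (X ^+ p.+1) + p%:R * \tr (Y ^+ p.+1).
Proof.
move=> /psd_spectral[Z [l [ZZ -> l0]]] /psd_spectral[P [k [PP -> k0]]].
rewrite !conjdiagX // mxtrace_mulC tr_conjdiagM !tr_conjdiag //.
have [C1 C2] := orth_double_sum ZZ PP.
pose c i j := (Z *m P^T) i j ^+ 2.
have -> : \sum_i (\row_i0 l 0 i0 ^+ p.+1) 0 i = \sum_i \sum_j l 0 i ^+ p.+1 * c i j.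
  by apply: eq_bigr => i _; rewrite -mulr_sumr C1 mulr1 mxE.
have -> : \sum_i (\row_i0 k 0 i0 ^+ p.+1) 0 i = \sum_i \sum_j k 0 j ^+ p.+1 * c i j.
  rewrite exchange_big; apply: eq_bigr => i _.
  by rewrite -mulr_sumr C2 mulr1 mxE.
rewrite !mulr_sumr -big_split /= ler_sum // => i _.
rewrite !mulr_sumr -big_split /= ler_sum // => j _.
rewrite (mxE _ _ 0 j) -/(c i j).
have : 0 <= c i j by exact: sqr_ge0.
move: (c i j) => w w0; rewrite !mulrA -mulrDl ler_wpM2r //.
by rewrite -mulrA [l 0 i * _]mulrC young_nat.
Qed.

(** After averaging over squared overlaps, the scalar inequality is [young_nat] at 1 and [k * l],
    divided by [l ^+ p]. For [V = invmx Q] the lemma is the tangent inequality at [Q] of the convex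
    function tr X^(-p). *)
Lemma trace_young_inv n p (X V : 'M[R]_n) c : X^T = X -> 0 < c ->
  (forall x, c * nsq x <= qform X x) -> psd V ->
  p.+1%:R * \tr (V ^+ p) <= \tr (invmx X ^+ p) + p%:R * \tr (V ^+ p.+1 *m X).
Proof.
move=> Xs c0 Xc /psd_spectral[P [k [PP -> k0]]].
have [Z [l [ZZ XE]]] := sym_spectral Xs.
have l0 i : 0 < l 0 i.
  by apply: (lt_le_trans c0); apply: (diag_ge ZZ) => x; move: (Xc x); rewrite XE.
rewrite XE -/(conjdiag Z l) conjdiag_inv // => [|i]; last by rewrite gt_eqF.
rewrite !conjdiagX // [\tr (_ *m _)]mxtrace_mulC tr_conjdiagM !tr_conjdiag //.
have [C1 C2] := orth_double_sum ZZ PP.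
pose d i j := (Z *m P^T) i j ^+ 2.
have -> : \sum_i (\row_i0 (\row_i1 (l 0 i1)^-1) 0 i0 ^+ p) 0 i
   = \sum_i \sum_j (l 0 i)^-1 ^+ p * d i j.
  by apply: eq_bigr => i _; rewrite -mulr_sumr C1 mulr1 !mxE.
have -> : \sum_i (\row_i0 k 0 i0 ^+ p) 0 i = \sum_i \sum_j k 0 j ^+ p * d i j.
  rewrite exchange_big; apply: eq_bigr => i _.
  by rewrite -mulr_sumr C2 mulr1 mxE.
rewrite !mulr_sumr -big_split /= ler_sum // => i _.
rewrite !mulr_sumr -big_split /= ler_sum // => j _.
rewrite (mxE _ _ 0 j) -/(d i j).
have : 0 <= d i j by exact: sqr_ge0.
move: (d i j) => w w0; rewrite !mulrA -mulrDl ler_wpM2r //.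
have lp : 0 < l 0 i ^+ p by rewrite exprn_gt0.
rewrite -(ler_pM2r lp) mulrDl -exprMn mulVf ?gt_eqF // expr1n.
have := young_nat p ler01 (mulr_ge0 (k0 j) (ltW (l0 i))).
rewrite mulr1 expr1n !exprMn => H; apply: (le_trans _ (le_trans H _)); first by rewrite mulrA.
by rewrite le_eqVlt !exprS; apply/orP; left; apply/eqP; ring.
Qed.

End Potential.

(** * The inverse-power potential *)

Section Barrier.
Variable R : rcfType.

(** Chebyshev's sum inequality: twice the difference of the two sides is the double sum of [D s t],
    in which both power differences have the same sign. *)
Lemma chebyshev_moments (I : finType) (l w : I -> R) i j :
  (forall s, 0 <= l s) -> (forall s, 0 <= w s) ->
  (\sum_s l s ^+ i.+1 * w s) * (\sum_s l s ^+ j.+1 * w s) <=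
  (\sum_s l s * w s) * (\sum_s l s ^+ (i + j).+1 * w s).
Proof.
move=> l0 w0; rewrite -subr_ge0 -(pmulr_rge0 _ (ltr0Sn R 1)).
pose D s t := w s * w t * l s * l t * ((l s ^+ i - l t ^+ i) * (l s ^+ j - l t ^+ j)).
suff -> : 2 * ((\sum_s l s * w s) * (\sum_s l s ^+ (i + j).+1 * w s) -
    (\sum_s l s ^+ i.+1 * w s) * (\sum_s l s ^+ j.+1 * w s)) = \sum_s \sum_t D s t.
  apply: sumr_ge0 => s _; apply: sumr_ge0 => t _.
  apply: mulr_ge0; first by rewrite !mulr_ge0.
  have [st|/ltW ts] := leP (l s) (l t).
    by rewrite mulr_le0 // subr_le0 lerXn2r ?nnegrE.
  by rewrite mulr_ge0 // subr_ge0 lerXn2r ?nnegrE.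
rewrite mulr2n mulrDl !mul1r; set A := _ - _.
have A1 : A = \sum_s \sum_t (l s * w s * (l t ^+ (i + j).+1 * w t)
    - l s ^+ i.+1 * w s * (l t ^+ j.+1 * w t)).
  rewrite /A !mulr_suml -sumrB; apply: eq_bigr => s _.
  by rewrite !mulr_sumr -sumrB.
rewrite {1}A1 exchange_big A1 -big_split /=; apply: eq_bigr => s _.
rewrite -big_split /=; apply: eq_bigr => t _.
rewrite /D !exprS !exprD; ring.
Qed.

Lemma qform_moments n (V : 'M[R]_n) y i j : psd V ->
  qform (V ^+ i.+1) y * qform (V ^+ j.+1) y <= qform V y * qform (V ^+ (i + j).+1) y.
Proof.
move=> /psd_spectral[Z [l [ZZ -> l0]]].
have E k : qform (conjdiag Z l ^+ k) y = \sum_s l 0 s ^+ k * (Z *m y) s 0 ^+ 2.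
  by rewrite conjdiagX // qform_conjdiag; apply: eq_bigr => s _; rewrite mxE.
rewrite !E qform_conjdiag.
by apply: (@chebyshev_moments _ (l 0) (fun s => (Z *m y) s 0 ^+ 2)) => // s; exact: sqr_ge0.
Qed.

Lemma qform_mulr n (X Y Z : 'M[R]_n) (y : 'cV[R]_n) :
  qform (X * (Y * (y *m y^T) * Z)) y = qform (X * Y) y * qform Z y.
Proof.
rewrite /qform -!mulmxE !mulmxA.
rewrite -[y^T *m X *m Y *m y *m y^T *m Z *m y]mulmxA.
rewrite -[y^T *m X *m Y *m y *m y^T *m (Z *m y)]mulmxA.
by rewrite mxE big_ord1 mulmxA.
Qed.

Lemma sym_rank1 n (y : 'cV[R]_n) : (y *m y^T)^T = y *m y^T.
Proof. by rewrite trmx_mul trmxK. Qed.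

Lemma mxtrace_rank1 n (X : 'M[R]_n) (y : 'cV[R]_n) : \tr (X *m (y *m y^T)) = qform X y.
Proof. by rewrite mulmxA mxtrace_mulC mulmxA /mxtrace big_ord1. Qed.

(* [V] and [V'] need not commute, but as [V - V'] has rank one the mixed moments
   [b k j] satisfy a recursion that only involves the scalar moments [a k]. *)
Section Downdate.
Variables (n : nat) (V : 'M[R]_n) (y : 'cV[R]_n) (tau : R).
Hypotheses (Vpsd : psd V) (tau0 : 0 <= tau).
Let V' := V - tau *: (V * (y *m y^T) * V).
Hypothesis V'psd : psd V'.
Let a k := qform (V ^+ k) y.
Let b k j := qform (V * V' ^+ k * V ^+ j.+1) y.

Let bS k j : b k.+1 j = b k j.+1 - tau * b k 0 * a j.+2.
Proof.
rewrite /b /a exprSr (exprS V j.+1) expr1.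
move: (V ^+ j.+1) (V' ^+ k) => W U; rewrite /V'.
rewrite -[tau * _ * _]mulrA -qform_mulr -[tau * _](qformZ tau).
rewrite -[- qform _ _]mulN1r -(qformZ (-1)) -qformD; congr (qform _ _).
rewrite mulrBr mulrBr mulrBl -!mulmxE -!scalemxAr -scalemxAl scaleN1r.
by rewrite !mulmxA.
Qed.

Let b_ge0 k : 0 <= b k 0.
Proof.
have [_ /(_ (V *m y))] := psdX k V'psd.
by rewrite /qform trmx_mul Vpsd.1 /b /qform expr1 -!mulmxE !mulmxA.
Qed.

Let a_ge0 k : 0 <= a k. Proof. exact: (psdX k Vpsd).2. Qed.

Let b_le k j : b k j <= a (k + j).+2.
Proof.
elim: k j => [|k IH] j; first by rewrite /b expr0 mulr1 -exprS.
rewrite bS (le_trans _ (le_trans (IH j.+1) _)) ?addnS ?addSn //.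
by rewrite gerBl mulr_ge0 // mulr_ge0.
Qed.

(** Each step of the recursion loses at most [tau * qform V y * a (k + j).+3]: [b k 0] is at most
    [a k.+2], and [qform_moments] bounds [a k.+2 * a j.+2]. *)
Let b_ge k j : (1 - k%:R * (tau * qform V y)) * a (k + j).+2 <= b k j.
Proof.
elim: k j => [|k IH] j; first by rewrite /b mul0r subr0 mul1r expr0 mulr1 -exprS.
rewrite bS; have := IH j.+1; rewrite addnS addSn => H.
have H2 : b k 0 * a j.+2 <= qform V y * a (k + j).+3.
  apply: le_trans (_ : a k.+2 * a j.+2 <= _); last first.
    by have := qform_moments y k.+1 j.+1 Vpsd; rewrite addnS addSn.
  by rewrite ler_wpM2r // -[k.+2]/(k.+2) -{2}(addn0 k) b_le.
have := ler_wpM2l tau0 H2; rewrite -natr1; nra.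
Qed.

(** By [trace_young], it is enough to bound tr(V'^p V) from below. That trace equals tr V'^(p+1)
    plus [tau * b p 0], and [b_ge] applies. *)
Lemma trace_downdate p :
  \tr (V' ^+ p.+1) + p.+1%:R * (tau * ((1 - p%:R * (tau * qform V y)) * qform (V ^+ p.+2) y))
  <= \tr (V ^+ p.+1).
Proof.
have := trace_young p Vpsd V'psd.
have -> : \tr (V' ^+ p *m V) = \tr (V' ^+ p.+1) + tau * b p 0.
  rewrite -{1}(subrK (tau *: (V * (y *m y^T) * V)) V) -/V' mulmxDr linearD /=.
  rewrite mulmxE -exprSr -mulmxE -scalemxAr linearZ /=; congr (_ + _ * _).
  by rewrite /b expr1 -mxtrace_rank1 -!mulmxE -!mulmxA [RHS]mxtrace_mulC !mulmxA
    mxtrace_mulC !mulmxA.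
have := b_ge p 0; rewrite addn0 => /(ler_wpM2l tau0).
rewrite mulrDr -natr1 => H1 H2.
have p0 : 0 <= p%:R + 1 :> R by rewrite natr1.
have := ler_wpM2l p0 H1; rewrite /a; lra.
Qed.

End Downdate.

(* Inverse-power potential playing the role of the exponential trace in the
   matrix Chernoff method. *)
Definition potential n p (Q : 'M[R]_n) : R := \tr (invmx Q ^+ p).

Section UniformlyPositive.
Variables (n : nat) (Q : 'M[R]_n) (c : R).
Hypotheses (Qs : Q^T = Q) (c0 : 0 < c) (Qc : forall x, c * nsq x <= qform Q x).

Lemma pd_spectral : exists (Z : 'M[R]_n) (l : 'rV[R]_n),
  [/\ Z *m Z^T = 1%:M, Q = conjdiag Z l, forall i, c <= l 0 i &
      invmx Q = conjdiag Z (\row_i (l 0 i)^-1)].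
Proof.
have [Z [l [ZZ QE]]] := sym_spectral Qs.
have lc i : c <= l 0 i by apply: (diag_ge ZZ) => x; move: (Qc x); rewrite QE.
exists Z, l; split => //; rewrite QE -/(conjdiag Z l) conjdiag_inv // => i.
by rewrite gt_eqF // (lt_le_trans c0).
Qed.

Lemma pd_inv_psd : psd (invmx Q).
Proof.
have [Z [l [ZZ QE lc ->]]] := pd_spectral; split; first exact: conjdiag_sym.
move=> x; rewrite qform_conjdiag sumr_ge0 // => i _.
by rewrite mxE mulr_ge0 ?sqr_ge0 // invr_ge0 (le_trans (ltW c0)).
Qed.

Lemma qform_inv_le x : qform (invmx Q) x <= c^-1 * nsq x.
Proof.
have [Z [l [ZZ QE lc ->]]] := pd_spectral.
rewrite qform_conjdiag -(nsq_orth ZZ) mulr_sumr ler_sum // => i _.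
rewrite mxE ler_wpM2r ?sqr_ge0 // lef_pV2 ?posrE //.
by rewrite (lt_le_trans c0).
Qed.

Lemma pd_unit : Q \in unitmx.
Proof.
have [Z [l [ZZ QE lc _]]] := pd_spectral.
have H : conjdiag Z l *m conjdiag Z (\row_i (l 0 i)^-1) = 1%:M.
  rewrite conjdiagM // -(conjdiag1 ZZ); congr conjdiag; apply/rowP => i.
  by rewrite !mxE mulfV // gt_eqF // (lt_le_trans c0).
by have [] := mulmx1_unit H; rewrite QE.
Qed.

Lemma potential_le p : potential p Q <= n%:R * c^-1 ^+ p.
Proof.
have [Z [l [ZZ QE lc QI]]] := pd_spectral.
rewrite /potential QI conjdiagX // tr_conjdiag // -[n in n%:R]card_ord.
rewrite mulr_natl -sumr_const ler_sum // => i _; rewrite !mxE.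
have li : 0 < l 0 i by rewrite (lt_le_trans c0).
by rewrite lerXn2r ?nnegrE ?invr_ge0 ?(ltW c0) ?(ltW li) // lef_pV2.
Qed.

(** One direction of small energy forces an eigenvalue below [d], which alone contributes this much
    to the trace. A large potential is thus the witness of failure in the Markov argument. *)
Lemma potential_ge p d x : qform Q x < d * nsq x -> d^-1 ^+ p <= potential p Q.
Proof.
have [Z [l [ZZ QE lc QI]]] := pd_spectral.
move=> Qd; have [i li] : exists i, l 0 i < d.
  apply/existsP; apply: contraTT Qd; rewrite negb_exists => /forallP Ql.
  rewrite -leNgt QE qform_conjdiag -(nsq_orth ZZ) mulr_sumr ler_sum // => i _.
  by rewrite ler_wpM2r ?sqr_ge0 // leNgt.
rewrite /potential QI conjdiagX // tr_conjdiag // (bigD1 i) //= !mxE.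
have lp j : 0 < l 0 j by rewrite (lt_le_trans c0).
rewrite -[leLHS]addr0 lerD // ?sumr_ge0 // => [|j _]; last first.
  by rewrite !mxE exprn_ge0 // invr_ge0 ltW.
have d0 : 0 < d by rewrite (lt_trans (lp i)).
by rewrite lerXn2r ?nnegrE ?invr_ge0 ?(ltW d0) ?(ltW (lp i)) // lef_pV2 ?posrE // ltW.
Qed.

End UniformlyPositive.

Lemma sherman_morrison n (V Q : 'M[R]_n) (y : 'cV[R]_n) : V *m Q = 1%:M ->
  1 + qform V y != 0 ->
  (V - (1 + qform V y)^-1 *: (V * (y *m y^T) * V)) *m (Q + y *m y^T) = 1%:M.
Proof.
move=> VQ b0; set b := qform V y in b0 *; set t := (1 + b)^-1.
rewrite -!mulmxE mulmxBl !mulmxDr VQ -scalemxAl -!mulmxA VQ mulmx1.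
rewrite -scalemxAl; set Y := V *m (y *m y^T).
have -> : V *m (y *m (y^T *m V)) *m (y *m y^T) = b *: Y.
  transitivity ((V *m y) *m (y^T *m V *m y) *m y^T); first by rewrite !mulmxA.
  by rewrite [y^T *m V *m y]mx11_scalar mul_mx_scalar -scalemxAl /Y mulmxA.
have -> : t *: (b *: Y) = Y - t *: Y.
  rewrite scalerA -[X in X - _]scale1r -scalerBl; congr (_ *: _).
  by rewrite /t; field.
by rewrite [t *: Y + _]addrC subrK addrK.
Qed.

(** Sherman-Morrison turns the update of [Q] into a downdate of [V = invmx Q] with
    [tau = (1 + b)^-1]. The bound on [nsq y] makes [b] so small that half of the first-order
    decrease survives. *)
Lemma potential_rank1 n p (Q : 'M[R]_n) (y : 'cV[R]_n) : Q^T = Q ->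
  (forall x, nsq x <= qform Q x) -> p.+2%:R * nsq y <= 2^-1 ->
  potential p.+1 (Q + y *m y^T) <=
  potential p.+1 Q - p.+1%:R / 2 * qform (invmx Q ^+ p.+2) y.
Proof.
move=> Qs Q1 yB.
have Q1' x : 1 * nsq x <= qform Q x by rewrite mul1r.
have Vpsd := pd_inv_psd Qs ltr01 Q1'.
set V := invmx Q in Vpsd *; set Q' := Q + _.
have Q's : Q'^T = Q' by rewrite linearD /= sym_rank1 Qs.
have Q'1 x : 1 * nsq x <= qform Q' x.
  by rewrite qformD qform_rank1 -[leLHS]addr0 lerD ?sqr_ge0.
have V'psd := pd_inv_psd Q's ltr01 Q'1.
set b := qform V y; have b0 : 0 <= b by exact: Vpsd.2.
have bB : p.+2%:R * b <= 2^-1.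
  apply: le_trans yB; rewrite ler_wpM2l //.
  by have := qform_inv_le Qs ltr01 Q1' y; rewrite invr1 mul1r.
pose t := (1 + b)^-1.
have b1 : 1 + b != 0 by rewrite gt_eqF // ltr_pwDl.
have t0 : 0 <= t by rewrite invr_ge0 addr_ge0.
have VE : invmx Q' = V - t *: (V * (y *m y^T) * V).
  have VQ : V *m Q = 1%:M by rewrite mulVmx // (pd_unit Qs ltr01 Q1').
  have := sherman_morrison VQ b1; rewrite -/b -/t -/Q' => H.
  by rewrite -[LHS]mul1mx -H mulmxK // (pd_unit Q's ltr01 Q'1).
rewrite VE in V'psd; have := trace_downdate Vpsd t0 V'psd p.
rewrite /potential VE -/V -/b.
set a := qform (V ^+ _) y; have a0 : 0 <= a by exact: (psdX p.+2 Vpsd).2.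
have tE : t * (1 + b) = 1 by rewrite mulVf.
(* Multiplied by [(1 + b) ^+ 2], the claim becomes a polynomial inequality in [b], which follows
   from [p.+2%:R * b <= 2^-1]. *)
have tt : 2^-1 <= t * (1 - p%:R * (t * b)).
  have : 2^-1 * (1 + b) ^+ 2 <= 1 + b - p%:R * b.
    rewrite -[p.+2]addn2 natrD in bB; set P := p%:R in bB *.
    have Pb0 : 0 <= P * b by rewrite mulr_ge0 // ler0n.
    have b4 : b <= 4^-1 by lra.
    have bb : b * b <= 4^-1 * b by rewrite ler_wpM2r.
    by rewrite expr2; lra.
  move=> /(ler_wpM2l (mulr_ge0 t0 t0)).
  have -> : t * t * (2^-1 * (1 + b) ^+ 2) = 2^-1 * (t * (1 + b)) ^+ 2 by ring.
  have -> : t * t * (1 + b - p%:R * b) = t * (t * (1 + b) - p%:R * (t * b)) by ring.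
  by rewrite tE expr1n mulr1.
have p0 : 0 <= p.+1%:R * a :> R by rewrite mulr_ge0.
have := ler_wpM2l p0 tt; nra.
Qed.

(** Averaging [potential_rank1] gives a decrease of at least [p.+1%:R / 2] times tr(V^(p+2) M). This
    is exactly the first-order change along [2^-1 *: M], and by convexity the potential there lies
    above its tangent. *)
Theorem potential_average n p (T : finType) (w : T -> R) (y : T -> 'cV[R]_n)
  (Q : 'M[R]_n) : Q^T = Q -> (forall x, nsq x <= qform Q x) ->
  (forall t, 0 <= w t) -> \sum_t w t = 1 ->
  (forall t, p.+2%:R * nsq (y t) <= 2^-1) ->
  \sum_t w t * potential p.+1 (Q + y t *m (y t)^T) <=
  potential p.+1 (Q + 2^-1 *: \sum_t w t *: (y t *m (y t)^T)).
Proof.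
move=> Qs Q1 w0 w1 yB; set M := \sum_t w t *: _; set V := invmx Q.
have Q1' x : 1 * nsq x <= qform Q x by rewrite mul1r.
have trM : \sum_t w t * qform (V ^+ p.+2) (y t) = \tr (V ^+ p.+2 *m M).
  rewrite mulmx_sumr linear_sum /=; apply: eq_bigr => t _.
  by rewrite -scalemxAr linearZ /= mxtrace_rank1.
have Ms : (Q + 2^-1 *: M)^T = Q + 2^-1 *: M.
  rewrite linearD linearZ /= Qs linear_sum /=; congr (_ + _ *: _).
  by apply: eq_bigr => t _; rewrite linearZ /= sym_rank1.
have M1 x : 1 * nsq x <= qform (Q + 2^-1 *: M) x.
  rewrite qformD -[leLHS]addr0 lerD // qformZ mulr_ge0 ?invr_ge0 // /M qform_sum.
  by apply: sumr_ge0 => t _; rewrite qformZ qform_rank1 mulr_ge0 ?sqr_ge0.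
have := trace_young_inv p.+1 Ms ltr01 M1 (pd_inv_psd Qs ltr01 Q1').
rewrite -/V -/(potential p.+1 (Q + 2^-1 *: M)) mulmxDr linearD /=.
have -> : V ^+ p.+2 *m Q = V ^+ p.+1.
  rewrite exprSr -mulmxE -mulmxA mulVmx ?mulmx1 //.
  exact: pd_unit Qs ltr01 Q1'.
rewrite -scalemxAr linearZ /= -trM => H.
apply: le_trans (_ : \sum_t w t * (potential p.+1 Q - p.+1%:R / 2 * qform (V ^+ p.+2) (y t)) <= _).
  by apply: ler_sum => t _; rewrite ler_wpM2l // potential_rank1.
under eq_bigr do rewrite mulrBr mulrCA.
rewrite sumrB -mulr_suml w1 mul1r -mulr_sumr.
move: H; rewrite /potential -/V -[p.+2%:R]natr1; set S := \sum_t _; lra.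
Qed.

End Barrier.

(** * Finite product expectations and power inequalities *)

Section ProductExpectation.
Variables (R : rcfType) (I T : finType) (q : I -> T -> R).
Implicit Types f g : {ffun I -> T} -> R.

(** Expectation over independent coordinates. Finite sums suffice because the signs and supports of
    an SJLT take finitely many values. *)
Definition pE (f : {ffun I -> T} -> R) : R := \sum_(a : {ffun I -> T}) (\prod_i q i (a i)) * f a.

Definition upd (i : I) (t : T) (a : {ffun I -> T}) : {ffun I -> T} :=
  [ffun k => if k == i then t else a k].

Hypotheses (q0 : forall i t, 0 <= q i t) (q1 : forall i, \sum_t q i t = 1).

Lemma prod_mass_ge0 (a : {ffun I -> T}) : 0 <= \prod_i q i (a i).
Proof. exact: prodr_ge0. Qed.

Lemma pE_prod (phi : I -> T -> R) :
  pE (fun a => \prod_i phi i (a i)) = \prod_i \sum_t q i t * phi i t.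
Proof.
rewrite bigA_distr_bigA; apply: eq_bigr => a _.
by rewrite -big_split.
Qed.

Lemma pE_cst c : pE (fun=> c) = c.
Proof.
rewrite /pE -mulr_suml (_ : \sum_a _ = 1) ?mul1r //.
transitivity (pE (fun a => \prod_i (fun _ _ => 1) i (a i))).
  by apply: eq_bigr => a _; rewrite [X in _ * X]big1 ?mulr1.
rewrite (pE_prod (fun _ _ => 1)) big1 // => i _; under eq_bigr do rewrite mulr1; exact: q1.
Qed.

Lemma pE_mono f g : (forall a, f a <= g a) -> pE f <= pE g.
Proof. by move=> fg; apply: ler_sum => a _; rewrite ler_wpM2l // prod_mass_ge0. Qed.

(** Restricting to the support matters because only columns of positive mass are known to have
    exactly [s] ones. *)
Lemma pE_mono_supp f g : (forall a : {ffun I -> T}, (forall i, q i (a i) != 0) -> f a <= g a) ->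
  pE f <= pE g.
Proof.
move=> fg; apply: ler_sum => a _.
have [->|a0] := eqVneq (\prod_i q i (a i)) 0; first by rewrite !mul0r.
rewrite ler_wpM2l ?prod_mass_ge0 // fg // => i.
by apply: contraNneq a0 => ai; rewrite (bigD1 i) //= ai mul0r.
Qed.

Lemma pE_ge0 f : (forall a, 0 <= f a) -> 0 <= pE f.
Proof. by move=> f0; apply: sumr_ge0 => a _; rewrite mulr_ge0 // prod_mass_ge0. Qed.

Lemma eq_pE f g : f =1 g -> pE f = pE g.
Proof. by move=> fg; apply: eq_bigr => a _; rewrite fg. Qed.

Lemma pED f g : pE (fun a => f a + g a) = pE f + pE g.
Proof. by rewrite /pE -big_split; apply: eq_bigr => a _; rewrite mulrDr. Qed.

Lemma pEZ c f : pE (fun a => c * f a) = c * pE f.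
Proof. by rewrite /pE mulr_sumr; apply: eq_bigr => a _; rewrite mulrCA. Qed.

Lemma pE_sum (J : Type) (r : seq J) (P : pred J) (F : J -> {ffun I -> T} -> R) :
  pE (fun a => \sum_(j <- r | P j) F j a) = \sum_(j <- r | P j) pE (F j).
Proof.
rewrite /pE exchange_big; apply: eq_bigr => a _; by rewrite mulr_sumr.
Qed.

Lemma prod_mass_upd i t (a : {ffun I -> T}) :
  (\prod_k q k (upd i t a k)) * q i (a i) = (\prod_k q k (a k)) * q i t.
Proof.
rewrite (bigD1 i) //= [in RHS](bigD1 i) //= ffunE eqxx.
rewrite [X in _ * X * _](eq_bigr (fun k => q k (a k))) => [|k ki]; first by ring.
by rewrite ffunE (negbTE ki).
Qed.

Lemma updK i t (a : {ffun I -> T}) : upd i (a i) (upd i t a) = a.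
Proof. by apply/ffunP => k; rewrite !ffunE; case: eqP => [->|]. Qed.

Lemma upd_same i t (a : {ffun I -> T}) : upd i t a i = t.
Proof. by rewrite ffunE eqxx. Qed.

(** Exchanging the old value [a i] with the fresh value [t] is an involution on the pairs [(a, t)]
    that preserves their joint weight. *)
Lemma pE_resample i f : pE f = pE (fun a => \sum_t q i t * f (upd i t a)).
Proof.
rewrite /pE; under [RHS]eq_bigr do rewrite mulr_sumr.
rewrite pair_bigA /= (reindex_inj (h := fun p => (upd i p.2 p.1, p.1 i))) /=; last first.
  apply: (can_inj (g := fun p => (upd i p.2 p.1, p.1 i))) => -[a t] /=.
  by rewrite updK upd_same.
rewrite -(pair_bigA _ (fun a t => (\prod_k q k (upd i t a k)) *
   (q i (a i) * f (upd i (a i) (upd i t a))))) /=.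
apply: eq_bigr => a _; under [RHS]eq_bigr do rewrite updK mulrA prod_mass_upd -mulrA.
by rewrite -mulr_sumr -mulr_suml q1 mul1r.
Qed.

End ProductExpectation.

Section PowerInequalities.
Variable R : realFieldType.

(** [young_nat] at the mean [X] is the tangent inequality of the power function; it is averaged with
    weights [p]. *)
Lemma jensen_pow (I : finType) (p u : I -> R) k : (forall i, 0 <= p i) ->
  \sum_i p i = 1 -> (forall i, 0 <= u i) ->
  (\sum_i p i * u i) ^+ k <= \sum_i p i * u i ^+ k.
Proof.
move=> p0 p1 u0; case: k => [|k].
  by rewrite expr0 (eq_bigr p) ?p1 // => i _; rewrite expr0 mulr1.
set X := \sum_i p i * u i.
have X0 : 0 <= X by apply: sumr_ge0 => i _; rewrite mulr_ge0.
have H : k.+1%:R * X ^+ k.+1 <= \sum_i p i * u i ^+ k.+1 + k%:R * X ^+ k.+1.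
  have -> : k.+1%:R * X ^+ k.+1 = \sum_i p i * (k.+1%:R * (X ^+ k * u i)).
    by rewrite exprSr {2}/X !mulr_sumr; apply: eq_bigr => i _; ring.
  have -> : k%:R * X ^+ k.+1 = \sum_i p i * (k%:R * X ^+ k.+1).
    by rewrite -mulr_suml p1 mul1r.
  rewrite -big_split; apply: ler_sum => i _ /=.
  by rewrite -mulrDr ler_wpM2l // young_nat.
by move: H; rewrite -natr1 mulrDl mul1r addrC lerD2r.
Qed.

(** The triangle inequality in a weighted power norm, phrased without roots. For positive [a] and
    [b], [(x + y) / (a + b)] is a convex combination of [x / a] and [y / b], to which Jensen
    applies. *)
Lemma minkowski_pow (I : finType) (w x y : I -> R) k a b :
  (forall i, 0 <= w i) -> (forall i, 0 <= x i) -> (forall i, 0 <= y i) ->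
  0 <= a -> 0 <= b ->
  \sum_i w i * x i ^+ k.+1 <= a ^+ k.+1 -> \sum_i w i * y i ^+ k.+1 <= b ^+ k.+1 ->
  \sum_i w i * (x i + y i) ^+ k.+1 <= (a + b) ^+ k.+1.
Proof.
move=> w0 x0 y0.
(* The cases [a = 0] and [b = 0] are separate: a vanishing norm kills every weighted term. *)
have zero (z : I -> R) i : (forall j, 0 <= z j) ->
    \sum_j w j * z j ^+ k.+1 <= 0 ^+ k.+1 -> w i = 0 \/ z i = 0.
  move=> z0; rewrite expr0n /= => H.
  have : \sum_j w j * z j ^+ k.+1 == 0.
    by rewrite eq_le H sumr_ge0 // => j _; rewrite mulr_ge0 // exprn_ge0.
  rewrite psumr_eq0 => [|j _]; last by rewrite mulr_ge0 // exprn_ge0.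
  move=> /allP/(_ i (mem_index_enum _)); rewrite /= mulf_eq0 expf_eq0 /=.
  by case/orP => /eqP; [left|right].
rewrite le0r => /predU1P[-> b0 H1 H2|a0].
  rewrite add0r (le_trans _ H2) // ler_sum // => i _.
  by have [->|->] := zero _ i x0 H1; rewrite ?mul0r // add0r.
rewrite le0r => /predU1P[-> H1 H2|b0].
  rewrite addr0 (le_trans _ H1) // ler_sum // => i _.
  by have [->|->] := zero _ i y0 H2; rewrite ?mul0r // addr0.
move=> H1 H2; have ab0 : 0 < a + b by rewrite addr_gt0.
pose p (c : bool) := (if c then a else b) / (a + b).
have p0 c : 0 <= p c by rewrite divr_ge0 ?(ltW ab0) //; case: c; apply: ltW.
have p1 : \sum_c p c = 1.
  by rewrite big_bool /p /= -mulrDl divff // gt_eqF.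
have step i : (x i + y i) ^+ k.+1 <=
   (a + b) ^+ k.+1 * (p true * (x i / a) ^+ k.+1 + p false * (y i / b) ^+ k.+1).
  have u0 (c : bool) : 0 <= (if c then x i / a else y i / b).
    by case: c; rewrite divr_ge0 // ltW.
  have := jensen_pow k.+1 p0 p1 u0; rewrite !big_bool /=.
  move=> /(ler_wpM2l (ltW (exprn_gt0 k.+1 ab0))); rewrite -exprMn.
  congr (_ ^+ _ <= _); rewrite /p.
  by field; rewrite !gt_eqF.
apply: le_trans (_ : \sum_i w i * ((a + b) ^+ k.+1 *
   (p true * (x i / a) ^+ k.+1 + p false * (y i / b) ^+ k.+1)) <= _).
  by apply: ler_sum => i _; rewrite ler_wpM2l.
have -> : \sum_i w i * ((a + b) ^+ k.+1 *
   (p true * (x i / a) ^+ k.+1 + p false * (y i / b) ^+ k.+1)) =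
   (a + b) ^+ k.+1 * (p true * (\sum_i w i * x i ^+ k.+1) * a ^- k.+1 +
                   p false * (\sum_i w i * y i ^+ k.+1) * b ^- k.+1).
  rewrite !mulr_sumr !mulr_suml -big_split /= mulr_sumr; apply: eq_bigr => i _.
  by rewrite !expr_div_n; ring.
rewrite -[leRHS]mulr1 ler_wpM2l ?exprn_ge0 ?(ltW ab0) // -p1 big_bool lerD //.
  by rewrite -mulrA ler_piMr // ler_pdivrMr ?exprn_gt0 // mul1r.
by rewrite -mulrA ler_piMr // ler_pdivrMr ?exprn_gt0 // mul1r.
Qed.

(** One-coordinate case of hypercontractivity: [G + H + t] and [G + H - t] are the squared norms at
    the two values of a sign, with even part [G] and odd part [H]. *)
Lemma two_point_power (G H t : R) N k : 0 <= G -> 0 <= H -> t ^+ 2 <= 4 * G * H ->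
  (k <= N)%N ->
  2^-1 * ((G + H + t) ^+ k + (G + H - t) ^+ k) <= (G + (4 * N%:R + 1) * H) ^+ k.
Proof.
move=> G0 H0 tGH kN; pose s := G + H; pose B := G + (4 * N%:R + 1) * H.
rewrite -/s -/B.
have NH0 : 0 <= N%:R * H by rewrite mulr_ge0.
have sB : s <= B by rewrite /s /B; lra.
have B0 : 0 <= B by rewrite /B; lra.
(* The induction closes only if [t] times the odd part of [(s + t) ^+ k] is bounded along with the
   even part. *)
suff : 2^-1 * ((s + t) ^+ k + (s - t) ^+ k) <= B ^+ k /\
  t * (2^-1 * ((s + t) ^+ k - (s - t) ^+ k)) <= 4 * k%:R * H * B ^+ k by case.
elim: k kN => [|k IH] kN; first by rewrite !expr0; split; lra.
have [] := IH (ltnW kN); rewrite !exprS.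
set P := 2^-1 * _; set D := 2^-1 * _; move=> HP HD.
have Bk : 0 <= B ^+ k by rewrite exprn_ge0.
have -> : 2^-1 * ((s + t) * (s + t) ^+ k + (s - t) * (s - t) ^+ k) = s * P + t * D.
  by rewrite /P /D; field.
have -> : t * (2^-1 * ((s + t) * (s + t) ^+ k - (s - t) * (s - t) ^+ k)) =
   s * (t * D) + t ^+ 2 * P by rewrite /P /D; field.
have s0 : 0 <= s by rewrite addr_ge0.
have kN' : k%:R + 1 <= N%:R :> R by rewrite natr1 ler_nat.
split.
  apply: le_trans (_ : s * B ^+ k + 4 * k%:R * H * B ^+ k <= _).
    by rewrite lerD // ler_wpM2l.
  rewrite -mulrDl ler_wpM2r // /s /B.
  have : k%:R * H <= N%:R * H by rewrite ler_wpM2r //; lra.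
  by lra.
have k0 : 0 <= k%:R * H by rewrite mulr_ge0.
apply: le_trans (_ : B * (4 * k%:R * H * B ^+ k) + 4 * B * H * B ^+ k <= _); last first.
  by rewrite -natr1; lra.
apply: lerD.
  apply: le_trans (ler_wpM2l s0 HD) _; rewrite ler_wpM2r //.
  by rewrite !mulr_ge0.
apply: le_trans (ler_wpM2l (sqr_ge0 t) HP) _; rewrite ler_wpM2r //.
apply: le_trans tGH _; rewrite -!mulrA ler_wpM2l // ler_wpM2r // /B.
by lra.
Qed.

End PowerInequalities.

(** * Hypercontractivity on the hypercube *)

Section InnerProduct.
Variables (R : rcfType) (n : nat).
Implicit Types x y : 'cV[R]_n.

Definition ip x y : R := \sum_i x i 0 * y i 0.

Lemma ipE x y : ip x y = (x^T *m y) 0 0.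
Proof. by rewrite mxE; apply: eq_bigr => i _; rewrite mxE. Qed.

Lemma ipC x y : ip x y = ip y x.
Proof. by apply: eq_bigr => i _; rewrite mulrC. Qed.

Lemma ipxx x : ip x x = nsq x.
Proof. by apply: eq_bigr => i _; rewrite expr2. Qed.

Lemma ip_suml (J : Type) (r : seq J) (P : pred J) (F : J -> 'cV[R]_n) y :
  ip (\sum_(j <- r | P j) F j) y = \sum_(j <- r | P j) ip (F j) y.
Proof.
rewrite exchange_big; apply: eq_bigr => i _; by rewrite summxE mulr_suml.
Qed.

Lemma ip_sumr (J : Type) (r : seq J) (P : pred J) (F : J -> 'cV[R]_n) y :
  ip y (\sum_(j <- r | P j) F j) = \sum_(j <- r | P j) ip y (F j).
Proof. by rewrite ipC ip_suml; apply: eq_bigr => i _; rewrite ipC. Qed.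

Lemma ipZl c x y : ip (c *: x) y = c * ip x y.
Proof. by rewrite mulr_sumr; apply: eq_bigr => i _; rewrite mxE mulrA. Qed.

Lemma ip0l y : ip 0 y = 0.
Proof. by rewrite -(scale0r 0) ipZl mul0r. Qed.

Lemma ipZr c x y : ip x (c *: y) = c * ip x y.
Proof. by rewrite ipC ipZl ipC. Qed.

Lemma nsqZ c x : nsq (c *: x) = c ^+ 2 * nsq x.
Proof. by rewrite -!ipxx ipZl ipZr mulrA expr2. Qed.

Lemma nsqD x y : nsq (x + y) = nsq x + nsq y + 2 * ip x y.
Proof.
rewrite /nsq /ip mulr_sumr -!big_split; apply: eq_bigr => i _ /=.
by rewrite mxE sqrrD -mulr_natl; ring.
Qed.

Lemma nsqN x : nsq (- x) = nsq x.
Proof. by rewrite -scaleN1r nsqZ sqrrN expr1n mul1r. Qed.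

(** Cauchy-Schwarz by Lagrange's identity. *)
Lemma ip_sqr_le x y : ip x y ^+ 2 <= nsq x * nsq y.
Proof.
rewrite -subr_ge0 -(pmulr_rge0 _ (ltr0Sn R 1)).
suff -> : 2 * (nsq x * nsq y - ip x y ^+ 2) =
    \sum_i \sum_j (x i 0 * y j 0 - x j 0 * y i 0) ^+ 2.
  by apply: sumr_ge0 => i _; apply: sumr_ge0 => j _; exact: sqr_ge0.
rewrite mulr2n mulrDl !mul1r; set A := _ - _.
have A1 : A = \sum_i \sum_j (x i 0 ^+ 2 * y j 0 ^+ 2 - x i 0 * y i 0 * (x j 0 * y j 0)).
  rewrite /A expr2 !mulr_suml -sumrB; apply: eq_bigr => i _.
  by rewrite !mulr_sumr -sumrB.
rewrite {1}A1 exchange_big A1 -big_split /=; apply: eq_bigr => i _.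
by rewrite -big_split /=; apply: eq_bigr => j _; ring.
Qed.

Lemma scale_half_double c x : (c / 2) *: (x + x) = c *: x.
Proof.
by rewrite -[in LHS](scale1r x) -scalerDl scalerA; congr (_ *: _); field.
Qed.

End InnerProduct.

Section Hypercube.
Variables (R : rcfType) (I : finType).
Local Notation cube := {ffun I -> bool}.

Definition sgb (b : bool) : R := (-1) ^+ b.

Definition rE (f : cube -> R) : R := pE (fun _ _ => 2^-1) f.

Definition flip (i : I) (a : cube) : cube := upd i (~~ a i) a.

Lemma half_ge0 (i : I) (b : bool) : 0 <= 2^-1 :> R. Proof. by rewrite invr_ge0. Qed.

Lemma half_sum1 (i : I) : \sum_(b : bool) 2^-1 = 1 :> R.
Proof. by rewrite big_bool /=; field. Qed.

Lemma sgbN b : sgb (~~ b) = - sgb b.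
Proof. by case: b; rewrite /sgb /= ?expr1 ?expr0 ?opprK. Qed.

Lemma sgb_sqr b : sgb b * sgb b = 1.
Proof. by case: b; rewrite /sgb /= ?expr1 ?expr0 ?mulrNN mulr1. Qed.

Lemma flip_same i a : flip i a i = ~~ a i.
Proof. by rewrite /flip upd_same. Qed.

Lemma flip_other i k a : k != i -> flip i a k = a k.
Proof. by move=> ki; rewrite ffunE (negbTE ki). Qed.

Lemma flipK i : involutive (flip i).
Proof. by move=> a; apply/ffunP => k; rewrite !ffunE eqxx; case: eqP => [->|]; rewrite ?negbK. Qed.

Lemma flipC i k a : flip i (flip k a) = flip k (flip i a).
Proof.
have [->//|ik] := eqVneq i k.
have ki : k != i by rewrite eq_sym.
apply/ffunP => l; rewrite !ffunE (negbTE ik) (negbTE ki).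
by case: (eqVneq l i) => // ->; rewrite (negbTE ik).
Qed.

Lemma rE_flip i f : rE (fun a => f (flip i a)) = rE f.
Proof.
rewrite /rE (pE_resample half_sum1 i) [RHS](pE_resample half_sum1 i).
apply: eq_bigr => a _; congr (_ * _); rewrite !big_bool /= addrC.
have H t : flip i (upd i t a) = upd i (~~ t) a.
  by apply/ffunP => k; rewrite !ffunE eqxx; case: eqP.
by rewrite !H.
Qed.

Lemma rE_odd i f : (forall a, f (flip i a) = - f a) -> rE f = 0.
Proof.
move=> fi; have H : rE f = - rE f.
  rewrite -{1}(rE_flip i) -mulN1r -pEZ; apply: eq_pE => a.
  by rewrite fi mulN1r.
by move: H; lra.
Qed.

Lemma rE_sym i f : rE f = rE (fun a => 2^-1 * (f a + f (flip i a))).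
Proof. by rewrite /rE pEZ pED -/(rE _) -/(rE _) (rE_flip i); field. Qed.

Section VectorValued.
Variable n : nat.
Implicit Types f g h : cube -> 'cV[R]_n.

(** As a polynomial in the sign of coordinate [i], [f] has constant term [avg i f] and linear
    coefficient [diff i f], both independent of that sign. *)
Definition avg i f : cube -> 'cV[R]_n := fun a => 2^-1 *: (f a + f (flip i a)).
Definition diff i f : cube -> 'cV[R]_n :=
  fun a => (sgb (a i) / 2) *: (f a - f (flip i a)).

(** Degree as a multilinear polynomial in the signs, tested by iterated differences so that no
    Fourier expansion is required. *)
Fixpoint degree_le d f : Prop :=
  match d with
  | 0 => forall i a, f (flip i a) = f a
  | d'.+1 => forall i, degree_le d' (diff i f)
  end.

Definition depends_on (J : {set I}) f :=
  forall i, i \notin J -> forall a, f (flip i a) = f a.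

Lemma avg_diff i f a : f a = avg i f a + sgb (a i) *: diff i f a.
Proof.
rewrite /avg /diff scalerA mulrA sgb_sqr mul1r -scalerDr addrACA subrr addr0.
by rewrite -[2^-1]mul1r scale_half_double scale1r.
Qed.

Lemma avg_flip i f a : avg i f (flip i a) = avg i f a.
Proof. by rewrite /avg flipK addrC. Qed.

Lemma diff_flip i f a : diff i f (flip i a) = diff i f a.
Proof. by rewrite /diff flipK flip_same sgbN mulNr scaleNr -scalerN opprB. Qed.

Lemma flip_avg_diff i f a : f (flip i a) = avg i f a - sgb (a i) *: diff i f a.
Proof.
by rewrite (avg_diff i f (flip i a)) avg_flip diff_flip flip_same sgbN scaleNr.
Qed.

Lemma diff_avgC i k f : i != k -> diff i (avg k f) = avg k (diff i f).
Proof.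
move=> ik; apply: funext => a; rewrite /diff /avg flip_other //.
rewrite (flipC k i) -!scalerBr -scalerDr !scalerA mulrC; congr (_ *: _).
by rewrite opprD addrACA.
Qed.

Lemma diff_avg_same i f : diff i (avg i f) = fun=> 0.
Proof. by apply: funext => a; rewrite /diff avg_flip subrr scaler0. Qed.

Lemma diff0 i : diff i (fun=> 0) = fun=> 0.
Proof. by apply: funext => a; rewrite /diff subrr scaler0. Qed.

Lemma degree_le0 d : degree_le d (fun=> 0).
Proof. by elim: d => [//|d IH] i; rewrite diff0. Qed.

Lemma degree_le_avg d i f : degree_le d f -> degree_le d (avg i f).
Proof.
elim: d f => [|d IH] f /= Hf k.
  by move=> a; rewrite /avg flipC !Hf.
have [->|ki] := eqVneq k i; first by rewrite diff_avg_same; exact: degree_le0.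
by rewrite diff_avgC //; apply: IH.
Qed.

Lemma depends_avg J i f : depends_on J f -> depends_on (J :\ i) (avg i f).
Proof.
move=> fJ k; rewrite finset.in_setD1 negb_and negbK => /predU1P[-> a|kJ a].
  exact: avg_flip.
by rewrite /avg flipC !(fJ k kJ).
Qed.

Lemma depends_diff J i f : depends_on J f -> depends_on (J :\ i) (diff i f).
Proof.
move=> fJ k; rewrite finset.in_setD1 negb_and negbK => /predU1P[-> a|kJ a].
  exact: diff_flip.
have [->|ki] := eqVneq k i; first exact: diff_flip.
by rewrite /diff flipC !(fJ k kJ) flip_other // eq_sym.
Qed.

Lemma flip_invariant_const f : (forall i a, f (flip i a) = f a) ->
  forall a b, f a = f b.
Proof.
move=> fi a b; have [k] := ubnP #|[set i | a i != b i]|.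
elim: k a => // k IH a; rewrite ltnS => kn.
have [E| [i ab]] := set_0Vmem [set i | a i != b i].
  congr f; apply/ffunP => i; apply/eqP/negPn/negP => ab.
  by have := finset.in_set0 i; rewrite -E inE ab.
rewrite inE in ab; rewrite -(fi i); apply: IH; apply: leq_trans kn.
rewrite (cardsD1 i [set i | a i != b i]) inE ab add1n ltnS subset_leq_card //.
apply/fintype.subsetP => l; rewrite !inE; have [->|li] := eqVneq l i.
  by rewrite flip_same; case: (a i) ab; case: (b i).
by rewrite flip_other.
Qed.

Lemma rE_split i f (F : R -> R) : rE (fun a => F (nsq (f a))) =
  rE (fun a => 2^-1 * (F (nsq (avg i f a) + nsq (diff i f a) + 2 * (sgb (a i) * ip (avg i f a) (diff i f a)))
    + F (nsq (avg i f a) + nsq (diff i f a) - 2 * (sgb (a i) * ip (avg i f a) (diff i f a))))).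
Proof.
rewrite (rE_sym i); apply: eq_pE => a.
rewrite flip_avg_diff (avg_diff i f a).
move: (avg i f a) (diff i f a) => x y.
by rewrite -scaleNr !nsqD !nsqZ sqrrN !ipZr expr2 sgb_sqr mul1r mulNr mulrN.
Qed.

(* Bonami's lemma: induction on the coordinates, splitting [f] into its parts
   even and odd in one coordinate, then the triangle inequality in L^q. *)
Theorem hypercontractivity q d f : degree_le d f ->
  rE (fun a => nsq (f a) ^+ q.+1) <=
  ((4 * q.+1%:R + 1) ^+ d * rE (fun a => nsq (f a))) ^+ q.+1.
Proof.
set K : R := 4 * _ + 1; have K1 : 1 <= K by rewrite /K lerDr mulr_ge0.
have K0 : 0 <= K by apply: le_trans K1.
have E0 g : 0 <= rE (fun a => nsq (g a)).
  by apply: (pE_ge0 half_ge0) => a; exact: nsq_ge0.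
have const d' g : (forall i a, g (flip i a) = g a) ->
    rE (fun a => nsq (g a) ^+ q.+1) <= (K ^+ d' * rE (fun a => nsq (g a))) ^+ q.+1.
  move=> gi; have gc := flip_invariant_const gi.
  have -> : g = (fun=> g [ffun=> true]) by apply: funext => a; exact: gc.
  rewrite /rE !(pE_cst half_sum1) lerXn2r ?nnegrE ?nsq_ge0 //.
    by rewrite mulr_ge0 ?nsq_ge0 // exprn_ge0.
  by rewrite ler_peMl ?nsq_ge0 // exprn_ege1.
have : depends_on finset.setT f by move=> i; rewrite finset.in_setT.
move: [set: I] => J; have [k] := ubnP #|J|.
elim: k J d f => // k IH J d f; rewrite ltnS => Jk fJ fd.
have [J0| [i iJ]] := set_0Vmem J.
  by apply: const => i a; rewrite fJ // J0 finset.in_set0.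
case: d fd => [|d] fd; first exact: const.
have Jik : (#|J :\ i| < k)%N by apply: leq_trans Jk; rewrite (cardsD1 i J) iJ.
have Hg := IH _ d.+1 _ Jik (depends_avg (i := i) fJ) (degree_le_avg i fd).
have Hh := IH _ d _ Jik (depends_diff (i := i) fJ) (fd i).
rewrite (rE_split i f (fun x => x ^+ q.+1)).
rewrite (rE_split i f id).
set g := avg i f in Hg *; set h := diff i f in Hh *.
have -> : rE (fun a => 2^-1 * (nsq (g a) + nsq (h a) + 2 * (sgb (a i) * ip (g a) (h a))
   + (nsq (g a) + nsq (h a) - 2 * (sgb (a i) * ip (g a) (h a))))) =
   rE (fun a => nsq (g a)) + rE (fun a => nsq (h a)).
  by rewrite -pED; apply: eq_pE => a; field.
apply: le_trans (_ : rE (fun a => (nsq (g a) + K * nsq (h a)) ^+ q.+1) <= _).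
  apply: (pE_mono half_ge0) => a; apply: two_point_power; rewrite ?nsq_ge0 //.
  rewrite !exprMn expr2 (expr2 (sgb _)) sgb_sqr mul1r -mulrA.
  by have := ip_sqr_le (g a) (h a); lra.
rewrite mulrDr; apply: minkowski_pow => [a|a|a||||] //.
- exact: (prod_mass_ge0 half_ge0).
- exact: nsq_ge0.
- by rewrite mulr_ge0 // nsq_ge0.
- by rewrite mulr_ge0 // exprn_ge0.
- by rewrite mulr_ge0 // exprn_ge0.
(* [h] has degree one less than [f]; the power of [K] saved there pays for the [K] in front of
   [nsq (h a)]. *)
rewrite (exprS K d) -mulrA [leRHS]exprMn.
apply: le_trans (ler_wpM2l _ Hh); last exact: exprn_ge0.
rewrite -pEZ le_eqVlt; apply/orP; left; apply/eqP; apply: eq_bigr => a _.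
by rewrite exprMn.
Qed.

End VectorValued.
End Hypercube.

(** * Moments of Rademacher sums and of chaos of order two *)

Section Chaos.
Variables (R : rcfType) (I : finType) (n : nat).
Local Notation cube := {ffun I -> bool}.
Local Notation sgb := (sgb R).
Implicit Types f g : cube -> 'cV[R]_n.

Lemma diffD i f g : diff i (fun a => f a + g a) = fun a => diff i f a + diff i g a.
Proof.
by apply: funext => a; rewrite /diff opprD addrACA scalerDr.
Qed.

Lemma degree_leD d f g : degree_le d f -> degree_le d g ->
  degree_le d (fun a => f a + g a).
Proof.
elim: d f g => [|d IH] f g fd gd i; first by move=> a; rewrite fd gd.
by rewrite diffD; apply: IH; [exact: fd|exact: gd].
Qed.

Lemma degree_le_sum d (J : finType) (F : J -> cube -> 'cV[R]_n) :
  (forall j, degree_le d (F j)) -> degree_le d (fun a => \sum_j F j a).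
Proof.
move=> Fd; elim: (index_enum J) => [|j s IH].
  rewrite (_ : (fun a => _) = fun=> 0); first exact: degree_le0.
  by apply: funext => a; rewrite big_nil.
rewrite (_ : (fun a => _) = fun a => F j a + \sum_(k <- s) F k a).
  exact: degree_leD.
by apply: funext => a; rewrite big_cons.
Qed.

Lemma diff_sgb i x (v : 'cV[R]_n) :
  diff i (fun a : cube => sgb (a x) *: v) = fun a => if i == x then v else 0.
Proof.
apply: funext => a; rewrite /diff; have [->|ix] := eqVneq i x.
  by rewrite flip_same sgbN scaleNr opprK scale_half_double scalerA sgb_sqr scale1r.
by rewrite flip_other 1?eq_sym // subrr scaler0.
Qed.

Lemma degree_le_sgb x (v : 'cV[R]_n) : degree_le 1 (fun a : cube => sgb (a x) *: v).
Proof. by move=> i; rewrite diff_sgb. Qed.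

Lemma degree_le_sgb2 x y (v : 'cV[R]_n) : x != y ->
  degree_le 2 (fun a : cube => (sgb (a x) * sgb (a y)) *: v).
Proof.
move=> xy i.
have [->|ix] := eqVneq i x.
  rewrite (_ : diff _ _ = fun a : cube => sgb (a y) *: v); first exact: degree_le_sgb.
  apply: funext => a; rewrite /diff flip_same flip_other 1?eq_sym // sgbN.
  by rewrite mulNr scaleNr opprK scale_half_double scalerA mulrA sgb_sqr mul1r.
have [->|iy] := eqVneq i y.
  rewrite (_ : diff _ _ = fun a : cube => sgb (a x) *: v); first exact: degree_le_sgb.
  apply: funext => a; rewrite /diff flip_same flip_other // sgbN.
  by rewrite mulrN scaleNr opprK scale_half_double scalerA mulrCA sgb_sqr mulr1.
rewrite (_ : diff _ _ = fun=> 0); first exact: (@degree_le0 R I n 1).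
by apply: funext => a; rewrite /diff !flip_other 1?eq_sym // subrr scaler0.
Qed.

Lemma rE_sgb2 x y : rE (fun a : cube => sgb (a x) * sgb (a y)) = (x == y)%:R.
Proof.
have [->|xy] := eqVneq x y.
  rewrite (_ : (fun a => _) = fun=> 1); first by rewrite /rE (pE_cst (@half_sum1 _ _)).
  by apply: funext => a; rewrite sgb_sqr.
by apply: (rE_odd (i := x)) => a; rewrite flip_same flip_other 1?eq_sym // sgbN mulNr.
Qed.

Lemma rE_sgb4 x y x' y' : x != y -> x' != y' ->
  rE (fun a : cube => sgb (a x) * sgb (a y) * (sgb (a x') * sgb (a y'))) =
  ((x == x') && (y == y'))%:R + ((x == y') && (y == x'))%:R.
Proof.
move=> xy x'y'.
have one : rE (fun a : cube => sgb (a x) * sgb (a y) * (sgb (a x) * sgb (a y))) = 1.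
  rewrite (_ : (fun a => _) = fun=> 1); first by rewrite /rE (pE_cst (@half_sum1 _ _)).
  by apply: funext => a; rewrite mulrACA !sgb_sqr mulr1.
have yx : y != x by rewrite eq_sym.
have [xx'|xx'] := eqVneq x x'.
  subst x'; have [yy'|yy'] := eqVneq y y'.
    by rewrite -yy' one (negbTE xy) addr0.
  rewrite (negbTE x'y') addr0; apply: (rE_odd (i := y)) => a.
  have y'y : y' != y by rewrite eq_sym.
  by rewrite flip_same !flip_other // sgbN mulrN mulNr.
have x'x : x' != x by rewrite eq_sym.
have [xy'|xy'] := eqVneq x y'.
  subst y'; have [yx'|yx'] := eqVneq y x'.
    subst x'; rewrite add0r -[RHS]one; congr rE; apply: funext => a.
    by rewrite (mulrC (sgb (a y)) (sgb (a x))).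
  rewrite addr0; apply: (rE_odd (i := y)) => a.
  have x'y : x' != y by rewrite eq_sym.
  by rewrite flip_same !flip_other // sgbN mulrN mulNr.
have y'x : y' != x by rewrite eq_sym.
rewrite addr0; apply: (rE_odd (i := x)) => a.
by rewrite flip_same !flip_other // sgbN !mulNr.
Qed.

Lemma rE_linear_nsq (v : I -> 'cV[R]_n) :
  rE (fun a : cube => nsq (\sum_x sgb (a x) *: v x)) = \sum_x nsq (v x).
Proof.
rewrite (_ : (fun a => _) = fun a : cube => \sum_x \sum_y ip (v x) (v y) * (sgb (a x) * sgb (a y))).
  rewrite /rE pE_sum; apply: eq_bigr => x _; rewrite pE_sum.
  rewrite (bigD1 x) //= big1 => [|y yx]; rewrite pEZ -/(rE _) rE_sgb2.
    by rewrite eqxx mulr1 addr0 ipxx.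
  by rewrite eq_sym (negbTE yx) mulr0.
apply: funext => a; rewrite -ipxx ip_suml; apply: eq_bigr => x _.
rewrite ip_sumr; apply: eq_bigr => y _; rewrite ipZl ipZr; ring.
Qed.

(** By [rE_sgb4] the pair [(x, y)] correlates only with itself and with [(y, x)]. The inner product
    of [v x y] and [v y x] is at most the mean of their squared norms, whence the factor 2. *)
Lemma rE_quadratic_nsq (v : I -> I -> 'cV[R]_n) : (forall x, v x x = 0) ->
  rE (fun a : cube => nsq (\sum_x \sum_y (sgb (a x) * sgb (a y)) *: v x y)) <=
  2 * \sum_x \sum_y nsq (v x y).
Proof.
move=> v0.
pose c (p : I * I) (a : cube) := sgb (a p.1) * sgb (a p.2).
have -> : (fun a : cube => nsq (\sum_x \sum_y (sgb (a x) * sgb (a y)) *: v x y)) =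
  fun a => \sum_p \sum_p' ip (v p.1 p.2) (v p'.1 p'.2) * (c p a * c p' a).
  apply: funext => a; rewrite pair_bigA /= -ipxx ip_suml; apply: eq_bigr => p _.
  rewrite ip_sumr; apply: eq_bigr => p' _; rewrite ipZl ipZr /c; ring.
have E p : rE (fun a => \sum_p' ip (v p.1 p.2) (v p'.1 p'.2) * (c p a * c p' a)) =
   ip (v p.1 p.2) (v p.1 p.2) + ip (v p.1 p.2) (v p.2 p.1).
  rewrite /rE pE_sum; case: p => x y; rewrite /c /=.
  have [->|xy] := eqVneq x y.
    rewrite v0 big1 => [|p' _]; first by rewrite ip0l addr0.
    by rewrite pEZ ip0l mul0r.
  have T p' : pE (fun _ _ => 2^-1) (fun a : cube => ip (v x y) (v p'.1 p'.2) *
     (sgb (a x) * sgb (a y) * (sgb (a p'.1) * sgb (a p'.2)))) =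
     ip (v x y) (v p'.1 p'.2) * (((x, y) == p')%:R + ((y, x) == p')%:R).
    rewrite pEZ -/(rE _); case: p' => x' y' /=.
    have [->|x'y'] := eqVneq x' y'; first by rewrite v0 ipC ip0l !mul0r.
    by rewrite rE_sgb4 // !xpair_eqE [in X in _ * (_ + X)]andbC.
  under eq_bigr do rewrite T mulrDr.
  rewrite big_split /= (bigD1 (x, y)) //= big1 => [|p' pp']; last first.
    by rewrite eq_sym (negbTE pp') mulr0.
  rewrite eqxx mulr1 addr0; congr (_ + _).
  rewrite (bigD1 (y, x)) //= big1 => [|p' pp']; last first.
    by rewrite eq_sym (negbTE pp') mulr0.
  by rewrite eqxx mulr1 addr0.
rewrite /rE pE_sum; under eq_bigr do rewrite -/(rE _) E.
rewrite -(pair_bigA _ (fun x y => ip (v x y) (v x y) + ip (v x y) (v y x))) /=.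
have S : \sum_x \sum_y nsq (v y x) = \sum_x \sum_y nsq (v x y) by rewrite exchange_big.
have -> : 2 * \sum_x \sum_y nsq (v x y) = \sum_x \sum_y (nsq (v x y) + 2^-1 * (nsq (v x y) + nsq (v y x))).
  under [RHS]eq_bigr do rewrite big_split /= -mulr_sumr big_split /=.
  by rewrite big_split /= -mulr_sumr big_split /= S; field.
apply: ler_sum => x _; apply: ler_sum => y _; rewrite ipxx lerD2l.
have := nsq_ge0 (v x y - v y x); rewrite nsqD nsqN.
by rewrite -[- v y x]scaleN1r ipZr; lra.
Qed.

Theorem chaos2_moment q (v : I -> I -> 'cV[R]_n) : (forall x, v x x = 0) ->
  rE (fun a : cube => nsq (\sum_x \sum_y (sgb (a x) * sgb (a y)) *: v x y) ^+ q.+1) <=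
  ((4 * q.+1%:R + 1) ^+ 2 * (2 * \sum_x \sum_y nsq (v x y))) ^+ q.+1.
Proof.
move=> v0; pose f (a : cube) := \sum_x \sum_y (sgb (a x) * sgb (a y)) *: v x y.
have fd : degree_le 2 f.
  apply: degree_le_sum => x; apply: degree_le_sum => y.
  have [->|xy] := eqVneq x y; last exact: degree_le_sgb2.
  rewrite v0 (_ : (fun a => _) = fun=> 0); first exact: degree_le0.
  by apply: funext => a; rewrite scaler0.
apply: le_trans (hypercontractivity q fd) _.
have K0 : 0 <= (4 * q.+1%:R + 1 : R) ^+ 2 by exact: sqr_ge0.
have S0 : 0 <= \sum_x \sum_y nsq (v x y).
  by apply: sumr_ge0 => x _; apply: sumr_ge0 => y _; exact: nsq_ge0.
rewrite lerXn2r ?nnegrE //.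
- rewrite mulr_ge0 //; apply: (pE_ge0 (@half_ge0 _ _)) => a; exact: nsq_ge0.
- by apply: mulr_ge0 => //; apply: mulr_ge0.
- by rewrite ler_wpM2l // rE_quadratic_nsq.
Qed.

End Chaos.

(** Hypercontractivity with exponent 2 and degree 1, whose constant is [(4 * 2 + 1) ^+ 2 = 81]. *)
Lemma khintchine4 (R : rcfType) (I : finType) (c : I -> R) :
  rE (fun a : {ffun I -> bool} => (\sum_x sgb R (a x) * c x) ^+ 4) <=
  81 * (\sum_x c x ^+ 2) ^+ 2.
Proof.
pose v x : 'cV[R]_1 := const_mx (c x).
have fd : degree_le 1 (fun a : {ffun I -> bool} => \sum_x sgb R (a x) *: v x).
  by apply: degree_le_sum => x; exact: degree_le_sgb.
have N (a : {ffun I -> bool}) : nsq (\sum_x sgb R (a x) *: v x) = (\sum_x sgb R (a x) * c x) ^+ 2.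
  rewrite /nsq big_ord1 summxE; congr (_ ^+ _); apply: eq_bigr => x _.
  by rewrite !mxE.
have := hypercontractivity 1 fd; rewrite rE_linear_nsq.
rewrite (_ : (fun a => _) = fun a : {ffun I -> bool} => (\sum_x sgb R (a x) * c x) ^+ 4); last first.
  by apply: funext => a; rewrite N -exprM.
move=> /le_trans; apply; rewrite expr1 exprMn.
rewrite (_ : \sum_x nsq (v x) = \sum_x c x ^+ 2); last first.
  by apply: eq_bigr => x _; rewrite /nsq big_ord1 mxE.
by rewrite ler_wpM2r ?sqr_ge0 //; lra.
Qed.

(** * Sparse random columns *)

Section Columns.
Variables (R : realType) (m n s : nat).
Local Notation column := {ffun 'I_m -> bool}.
Variable q : 'I_n -> column -> R.
Hypotheses (q0 : forall j t, 0 <= q j t) (q1 : forall j, \sum_t q j t = 1).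
Hypothesis q_weight : forall j t, q j t != 0 -> (\sum_i t i)%N = s.
Hypothesis q_moment : forall j (I : {set 'I_m}),
  \sum_t q j t * \prod_(i in I) (t i)%:R <= (s%:R / m%:R) ^+ #|I|.
Implicit Types b : {ffun 'I_n -> column}.

(** Expanded over subsets, the product has nonnegative coefficients, so the moment hypothesis
    applies termwise: the column is dominated by independent entries of mean [s%:R / m%:R]. *)
Lemma column_prod_le j (y : 'I_m -> R) : (forall i, 0 <= y i) ->
  \sum_t q j t * \prod_i (y i * (t i)%:R + 1) <= \prod_i (y i * (s%:R / m%:R) + 1).
Proof.
move=> y0; rewrite [leRHS]bigA_distr.
under [leLHS]eq_bigr do rewrite bigA_distr mulr_sumr.
rewrite exchange_big; apply: ler_sum => J _ /=.
rewrite -big_mkcond big_split /= prodr_const.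
have -> : \sum_(t : column) q j t * \prod_i (if i \in J then y i * (t i)%:R else 1) =
   (\prod_(i in J) y i) * \sum_(t : column) q j t * \prod_(i in J) (t i)%:R.
  rewrite mulr_sumr; apply: eq_bigr => t _.
  by rewrite -big_mkcond big_split /= mulrCA.
by rewrite ler_wpM2l // prodr_ge0.
Qed.

Lemma expR_le_double (x : R) : 0 <= x -> x <= 2^-1 -> expR x <= 1 + 2 * x.
Proof.
move=> x0 x2; have := expR_ge1Dx (- x); rewrite expRN => H.
have H1 : 0 < 1 - x by lra.
have : expR x <= (1 - x)^-1 by rewrite -[expR x]invrK lef_pV2 ?posrE ?invr_gt0 ?expR_gt0.
move=> /le_trans; apply; rewrite -(ler_pM2r H1) mulVf ?gt_eqF //.
have : x * x <= 2^-1 * x by rewrite ler_wpM2r.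
by lra.
Qed.

Lemma column_exp_le j (S : {set 'I_m}) w : 0 <= w -> w <= 2^-1 ->
  \sum_t q j t * expR (w * \sum_(i in S) (t i)%:R) <=
  expR (2 * (#|S|%:R * (s%:R / m%:R)) * w).
Proof.
(* On an entry with values 0 and 1 the exponential is affine, with slope [expR w - 1]. *)
move=> w0 w2; pose y i := if i \in S then expR w - 1 else 0.
have e1 : 0 <= expR w - 1 by have := expR_ge1Dx w; lra.
have y0 i : 0 <= y i by rewrite /y; case: ifP.
have sm0 : 0 <= s%:R / m%:R :> R by rewrite divr_ge0.
have -> : \sum_t q j t * expR (w * \sum_(i in S) (t i)%:R) =
   \sum_t q j t * \prod_i (y i * (t i)%:R + 1).
  apply: eq_bigr => t _; congr (_ * _).
  rewrite mulr_sumr big_mkcond /= expR_sum; apply: eq_bigr => i _.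
  rewrite /y; case: ifP => _; last by rewrite mul0r add0r expR0.
  by case: (t i); rewrite ?mulr1 ?subrK // !mulr0 expR0 add0r.
apply: le_trans (column_prod_le j y0) _.
apply: le_trans (_ : \prod_i expR (y i * (s%:R / m%:R)) <= _).
  by apply: ler_prod => i _; rewrite addr_ge0 ?mulr_ge0 //= addrC expR_ge1Dx.
rewrite -expR_sum ler_expR -mulr_suml -big_mkcond sumr_const -[_ *+ _]mulr_natl.
have := expR_le_double w0 w2 => H.
have : #|S|%:R * (s%:R / m%:R) * (expR w - 1) <= #|S|%:R * (s%:R / m%:R) * (2 * w).
  by rewrite ler_wpM2l ?mulr_ge0 //; lra.
by rewrite /=; lra.
Qed.

Lemma columns_exp_le (S : {set 'I_m}) (w : 'I_n -> R) :
  (forall j, 0 <= w j) -> (forall j, w j <= 2^-1) ->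
  pE q (fun b => expR (\sum_j w j * \sum_(i in S) (b j i)%:R)) <=
  expR (2 * (#|S|%:R * (s%:R / m%:R)) * \sum_j w j).
Proof.
move=> w0 w2; rewrite (@eq_pE _ _ _ _ _ (fun b => \prod_j expR (w j * \sum_(i in S) (b j i)%:R))).
  rewrite (pE_prod _ (fun j (t : column) => expR (w j * \sum_(i in S) (t i)%:R))).
  rewrite mulr_sumr expR_sum; apply: ler_prod => j _.
  by rewrite column_exp_le // sumr_ge0 // => t _; rewrite mulr_ge0 // expR_ge0.
by move=> b; rewrite expR_sum.
Qed.

Section RowMasses.
Variables (u2 : 'I_n -> R) (M r : R).
Hypotheses (u20 : forall j, 0 <= u2 j) (u2M : forall j, u2 j <= M).
Hypothesis u2r : \sum_j u2 j = r.

Lemma row_mass_tail i l t : 0 <= l -> l * M <= 2^-1 ->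
  pE q (fun b => (t < \sum_j u2 j * (b j i)%:R)%R%:R) <=
  expR (2 * (s%:R / m%:R) * (l * r) - l * t).
Proof.
move=> l0 lM.
apply: le_trans (_ : pE q (fun b => expR (- (l * t)) *
  expR (\sum_j (l * u2 j) * \sum_(k in [set i]) (b j k)%:R)) <= _).
  apply: pE_mono => // b; rewrite -expRD.
  have -> : \sum_j l * u2 j * (\sum_(k in [set i]) (b j k)%:R) =
      l * \sum_j u2 j * (b j i)%:R.
    by rewrite mulr_sumr; apply: eq_bigr => j _; rewrite big_set1 mulrA.
  case: ltP => [H|_]; last exact: expR_ge0.
  rewrite -[leLHS]expR0 ler_expR addrC -mulrBr mulr_ge0 //.
  by rewrite subr_ge0 ltW.
rewrite pEZ addrC expRD ler_wpM2l ?expR_ge0 //.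
apply: le_trans (columns_exp_le _ _ _) _ => [j|j|].
- by rewrite mulr_ge0.
- by rewrite (le_trans _ lM) // ler_wpM2l.
by rewrite cards1 mul1r -mulr_sumr u2r.
Qed.

(** The weighted collisions of column [k] with the others: up to a factor, the variance that the
    [k]-th coordinate of the residual brings into the cross term. *)
Definition overlap (k : 'I_n) b : R :=
  \sum_(j | j != k) u2 j * \sum_i (b k i && b j i)%:R.

(** Column [k] is resampled and then frozen. Its support is a fixed set of size [s], and the overlap
    becomes a sum over the other columns to which [columns_exp_le] applies. *)
Lemma overlap_exp k l : 0 <= l -> l * M <= 2^-1 ->
  pE q (fun b => expR (l * overlap k b)) <= expR (2 * (s%:R * (s%:R / m%:R)) * (l * r)).
Proof.
move=> l0 lM; rewrite (pE_resample q1 k).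
pose w j : R := if j == k then 0 else l * u2 j.
have wE b t : l * overlap k (upd k t b) =
   \sum_j w j * \sum_(i in [set i | t i]) (b j i)%:R.
  rewrite /overlap mulr_sumr [RHS](bigD1 k) //= /w eqxx mul0r add0r.
  apply: eq_bigr => j jk; rewrite (negbTE jk) mulrA; congr (_ * _).
  rewrite [RHS]big_mkcond; apply: eq_bigr => i _.
  by rewrite inE !ffunE eqxx (negbTE jk); case: (t i).
rewrite (@eq_pE _ _ _ _ _ (fun b => \sum_t q k t *
    expR (\sum_j w j * \sum_(i in [set i | t i]) (b j i)%:R))); last first.
  by move=> b; apply: eq_bigr => t _; rewrite wE.
set bound := expR _; have -> : bound = \sum_t q k t * bound by rewrite -mulr_suml q1 mul1r.
rewrite pE_sum; apply: ler_sum => t _.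
rewrite pEZ; have [->|qt] := eqVneq (q k t) 0; first by rewrite !mul0r.
rewrite ler_wpM2l //.
have w0 j : 0 <= w j by rewrite /w; case: ifP => // _; rewrite mulr_ge0.
have w2 j : w j <= 2^-1.
  rewrite /w; case: ifP => _; first by rewrite invr_ge0.
  by rewrite (le_trans _ lM) // ler_wpM2l.
apply: le_trans (columns_exp_le [set i | t i] w0 w2) _.
have -> : #|[set i | t i]| = s.
  rewrite -(q_weight qt) -sum1_card big_mkcond; apply: eq_bigr => i _.
  by rewrite inE; case: (t i).
rewrite /bound ler_expR ler_wpM2l ?mulr_ge0 ?divr_ge0 //.
rewrite -u2r mulr_sumr; apply: ler_sum => j _; rewrite /w.
by case: ifP => _ //; rewrite mulr_ge0.
Qed.

(** Uses X^p <= Q^p exp(pX/Q). With [l = p%:R / Q], the two lower bounds on [Q] make [l * M] at most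
    1/2 and the exponent in [overlap_exp] at most [p]. *)
Lemma overlap_moment k p Q : 0 < Q -> 2 * (p%:R * M) <= Q ->
  2 * (s%:R * (s%:R / m%:R) * r) <= Q ->
  pE q (fun b => overlap k b ^+ p) <= (expR 1 * Q) ^+ p.
Proof.
move=> Q0 QM Qr; pose l := p%:R / Q.
have l0 : 0 <= l by rewrite divr_ge0 // ltW.
have lM : l * M <= 2^-1.
  rewrite /l mulrAC ler_pdivrMr //; lra.
have o0 b : 0 <= overlap k b.
  by apply: sumr_ge0 => j _; rewrite mulr_ge0 // sumr_ge0.
apply: le_trans (_ : pE q (fun b => Q ^+ p * expR (l * overlap k b)) <= _).
  apply: pE_mono => // b.
  have -> : l * overlap k b = p%:R * (overlap k b / Q) by rewrite /l mulrAC mulrA.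
  rewrite expRM_natl -exprMn lerXn2r ?nnegrE //.
    by rewrite mulr_ge0 ?expR_ge0 // ltW.
  rewrite mulrC -ler_pdivrMr //.
  by have := expR_ge1Dx (overlap k b / Q); lra.
rewrite pEZ exprMn mulrC ler_wpM2r ?exprn_ge0 ?(ltW Q0) //.
apply: le_trans (overlap_exp k l0 lM) _.
rewrite -expRM_natl mulr1 ler_expR /l.
have : (p%:R / Q) * (2 * (s%:R * (s%:R / m%:R) * r)) <= (p%:R / Q) * Q.
  by rewrite ler_wpM2l.
by rewrite mulfVK ?gt_eqF //; lra.
Qed.

End RowMasses.
End Columns.

(** * Lower tail of the sketched energy *)

Section RowExposure.
Variables (R : rcfType) (I T : finType) (w : I -> T -> R) (n p : nat).
Variable y : I -> T -> 'cV[R]_n.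
Hypotheses (w0 : forall i t, 0 <= w i t) (w1 : forall i, \sum_t w i t = 1).
Hypothesis yB : forall i t, p.+2%:R * nsq (y i t) <= 2^-1.

(** Rows are replaced by half their mean one at a time: row [i] is resampled with the others held in
    the base matrix, which stays above the identity as [potential_average] requires. *)
Lemma potential_rows (s : seq I) (Q : 'M[R]_n) : uniq s -> Q^T = Q ->
  (forall x, nsq x <= qform Q x) ->
  pE w (fun a => potential p.+1 (Q + \sum_(i <- s) y i (a i) *m (y i (a i))^T)) <=
  potential p.+1 (Q + \sum_(i <- s) 2^-1 *: \sum_t w i t *: (y i t *m (y i t)^T)).
Proof.
elim: s Q => [|i s IH] Q /=.
  move=> _ _ _; rewrite big_nil.
  rewrite (@eq_pE _ _ _ _ _ (fun=> potential p.+1 (Q + 0))) ?pE_cst //.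
  by move=> a; rewrite big_nil.
move=> /andP[si us] Qs Q1; pose M k : 'M[R]_n := 2^-1 *: \sum_t w k t *: (y k t *m (y k t)^T).
rewrite (pE_resample w1 i).
pose Y (a : {ffun I -> T}) := \sum_(k <- s) y k (a k) *m (y k (a k))^T.
have Ys a : (Y a)^T = Y a.
  by rewrite /Y linear_sum; apply: eq_bigr => k _; rewrite /= sym_rank1.
have Y0 a x : 0 <= qform (Y a) x.
  by rewrite /Y qform_sum sumr_ge0 // => k _; rewrite qform_rank1 sqr_ge0.
apply: le_trans (_ : pE w (fun a => potential p.+1 ((Q + M i) + Y a)) <= _).
  apply: pE_mono => // a.
  apply: le_trans (_ : potential p.+1 ((Q + Y a) + M i) <= _); last by rewrite addrAC.
  apply: le_trans (potential_average (w := w i) (y := y i) (p := p) _ _ _ _ _) => //.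
  - apply: ler_sum => t _; rewrite ler_wpM2l // big_cons upd_same.
    rewrite (_ : \sum_(j <- s) _ = Y a); first by rewrite addrA addrAC.
    apply: eq_big_seq => k ks; rewrite ffunE; case: eqP => // ki.
    by rewrite -ki ks in si.
  - by rewrite linearD /= Qs Ys.
  - by move=> x; rewrite qformD -[leLHS]addr0 lerD.
rewrite big_cons addrA; apply: IH => //.
  rewrite linearD /= Qs /M linearZ /= linear_sum /=; congr (_ + _ *: _).
  by apply: eq_bigr => t _; rewrite linearZ /= sym_rank1.
move=> x; rewrite qformD -[leLHS]addr0 lerD // /M qformZ mulr_ge0 ?invr_ge0 //.
by rewrite qform_sum sumr_ge0 // => t _; rewrite qformZ qform_rank1 mulr_ge0 ?sqr_ge0.
Qed.

End RowExposure.

Section Curry.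
Variables (R : rcfType) (I J : finType).

Definition uncurry_ffun (a : {ffun I -> {ffun J -> bool}}) : {ffun I * J -> bool} :=
  [ffun p => a p.1 p.2].

(** Regroups the signs into independent rows, the form in which [potential_rows] consumes them. *)
Lemma rE_curry (F : {ffun I * J -> bool} -> R) :
  rE F = pE (fun _ _ => \prod_(j : J) 2^-1) (fun a => F (uncurry_ffun a)).
Proof.
rewrite /rE /pE (reindex_onto uncurry_ffun
  (fun a : {ffun I * J -> bool} => [ffun i => [ffun j => a (i, j)]])) /=.
  rewrite (eq_bigl xpredT) => [|a]; last first.
    by apply/eqP/ffunP => i; apply/ffunP => j; rewrite !ffunE.
  by apply: eq_bigr => a _; rewrite pair_bigA.
by move=> a _; apply/ffunP => -[i j]; rewrite !ffunE.
Qed.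

Lemma prod_half_sum1 : \sum_(t : {ffun J -> bool}) \prod_(j : J) 2^-1 = 1 :> R.
Proof.
apply: etrans (pE_cst (@half_sum1 R J) 1).
by apply: eq_bigr => t _; rewrite mulr1.
Qed.

End Curry.

Section LowerTail.
Variables (R : realType) (m n r s p : nat) (u : 'I_n -> 'cV[R]_r).
Variable b : 'I_n -> {ffun 'I_m -> bool}.
Hypothesis u_frame : \sum_j u j *m (u j)^T = 1%:M.
Hypotheses (s_gt0 : (0 < s)%N) (b_weight : forall j, (\sum_i b j i)%N = s).

Definition row_mass i : R := \sum_j nsq (u j) * (b j i)%:R.

(** The transposed row [i] of Phi U for fixed supports [b], where the [u j] are the rows of U. *)
Definition sketch_row (a : {ffun 'I_n -> bool}) i : 'cV[R]_r :=
  \sum_j sgb R (a j) *: (((Num.sqrt s%:R)^-1 * (b j i)%:R) *: u j).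

Lemma inv_sqrt_sqr : (Num.sqrt s%:R)^-1 ^+ 2 = s%:R^-1 :> R.
Proof. by rewrite exprVn sqr_sqrtr. Qed.

Lemma nat_bool_sqr (c : bool) : (c%:R : R) ^+ 2 = c%:R.
Proof. by case: c; rewrite ?expr1n ?expr0n. Qed.

Lemma frame_sum x : \sum_j ip (u j) x ^+ 2 = nsq x.
Proof.
rewrite -qform1 -u_frame qform_sum; apply: eq_bigr => j _.
by rewrite qform_rank1 -ipE.
Qed.

Lemma rE_sketch_row_nsq i : rE (fun a => nsq (sketch_row a i)) = row_mass i / s%:R.
Proof.
rewrite /sketch_row rE_linear_nsq mulr_suml; apply: eq_bigr => j _.
by rewrite nsqZ exprMn inv_sqrt_sqr nat_bool_sqr; ring.
Qed.

Let e x i j : R := (Num.sqrt s%:R)^-1 * (b j i)%:R * ip (u j) x.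

Let v x i : R := \sum_j e x i j ^+ 2.

Lemma ip_sketch_row a i x : ip (sketch_row a i) x = \sum_j sgb R (a j) * e x i j.
Proof. by rewrite ip_suml; apply: eq_bigr => j _; rewrite !ipZl. Qed.

Lemma rE_ip_sketch_row_sqr i x : rE (fun a => ip (sketch_row a i) x ^+ 2) = v x i.
Proof.
have -> : (fun a => ip (sketch_row a i) x ^+ 2) =
    fun a => nsq (\sum_j sgb R (a j) *: (const_mx (e x i j) : 'cV[R]_1)).
  apply: funext => a; rewrite ip_sketch_row /nsq big_ord1 summxE; congr (_ ^+ _).
  by apply: eq_bigr => j _; rewrite !mxE.
by rewrite rE_linear_nsq; apply: eq_bigr => j _; rewrite /nsq big_ord1 mxE.
Qed.

(** The [s] ones of each column cancel the normalisation [s%:R^-1], and the frame identity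
    remains. *)
Lemma sum_row_variance x : \sum_i v x i = nsq x.
Proof.
rewrite exchange_big -frame_sum; apply: eq_bigr => j _ /=.
rewrite (eq_bigr (fun i => (b j i)%:R * (s%:R^-1 * ip (u j) x ^+ 2))) => [|i _].
  rewrite -mulr_suml -natr_sum b_weight mulrA mulfV ?mul1r //.
  by rewrite pnatr_eq0 -lt0n.
by rewrite /e !exprMn inv_sqrt_sqr nat_bool_sqr; ring.
Qed.

(** The threshold is the size bound of [potential_average]. Dropping a row only lowers the energy,
    which is harmless for a lower bound. *)
Definition truncated (y : 'cV[R]_r) := if p.+2%:R * nsq y <= 2^-1 then y else 0.

Lemma truncatedB y : p.+2%:R * nsq (truncated y) <= 2^-1.
Proof.
rewrite /truncated; case: ifP => // _.
by rewrite -ipxx ip0l mulr0 invr_ge0.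
Qed.

Lemma ip_truncated_le y x : ip (truncated y) x ^+ 2 <= ip y x ^+ 2.
Proof.
rewrite /truncated; case: ifP => // _.
by rewrite ip0l expr0n sqr_ge0.
Qed.

Hypothesis light_rows : forall i, row_mass i <= s%:R / (2592 * p.+2%:R).

(* A row escapes truncation with small probability, and by the fourth moment
   bound the escaping part carries little variance in every direction. *)
Lemma truncated_variance i x :
  3 / 4 * v x i <= rE (fun a => ip (truncated (sketch_row a i)) x ^+ 2).
Proof.
have v0 : 0 <= v x i by apply: sumr_ge0 => j _; exact: sqr_ge0.
pose big a : R := (~~ (p.+2%:R * nsq (sketch_row a i) <= 2^-1))%:R.
pose X a := ip (sketch_row a i) x.
have s0 : 0 < s%:R :> R by rewrite ltr0n.
(* Markov's inequality: the mean of [2 * p.+2%:R * nsq (sketch_row a i)] is at most 2/2592. *)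
have big_le : rE big <= 1296^-1.
  apply: le_trans (_ : rE (fun a => 2 * p.+2%:R * nsq (sketch_row a i)) <= _).
    apply: (pE_mono (@half_ge0 _ _)) => a; rewrite /big.
    case: (leP (p.+2%:R * nsq _)) => /= H; first by rewrite !mulr_ge0 ?nsq_ge0.
    by rewrite -mulrA; lra.
  rewrite /rE pEZ -/(rE _) rE_sketch_row_nsq.
  have := light_rows i; rewrite -(ler_pM2r (_ : 0 < s%:R^-1)) ?invr_gt0 // => H.
  have k0 : (0 : R) < p.+2%:R by [].
  apply: le_trans (ler_wpM2l _ H) _; first by rewrite mulr_ge0.
  by rewrite le_eqVlt; apply/orP; left; apply/eqP; field; rewrite !gt_eqF.
have split_ : rE (fun a => ip (truncated (sketch_row a i)) x ^+ 2) =
    v x i - rE (fun a => X a ^+ 2 * big a).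
  rewrite -rE_ip_sketch_row_sqr -[- rE _]mulN1r /rE -pEZ -pED; apply: eq_pE => a.
  rewrite /big /truncated /X; case: ifP => _ /=; first by ring.
  by rewrite ip0l expr0n /=; ring.
rewrite split_; suff H : rE (fun a => X a ^+ 2 * big a) <= v x i / 4 by lra.
have bigle1 a : 0 <= big a <= 1 by rewrite /big; case: (~~ _); rewrite ?lexx ?ler01.
have [vz|vn] := eqVneq (v x i) 0.
  have -> : v x i / 4 = v x i by rewrite vz mul0r.
  rewrite -(rE_ip_sketch_row_sqr i x).
  apply: (pE_mono (@half_ge0 _ _)) => a; rewrite -[leRHS]mulr1 ler_wpM2l ?sqr_ge0 //.
  by case/andP: (bigle1 a).
have vp : 0 < v x i by rewrite lt_def vn.
have k1 : 0 <= (648 * v x i)^-1 by rewrite invr_ge0; apply: mulr_ge0 (ler0n _ _) v0.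
have k2 : 0 <= 162 * v x i by apply: mulr_ge0 (ler0n _ _) v0.
(* Weighted arithmetic-geometric mean. The weights make both terms at most [v x i / 8] on average:
   81/648 = 1/8 by [khintchine4], and 162/1296 = 1/8. *)
apply: le_trans (_ : rE (fun a => (648 * v x i)^-1 * X a ^+ 4 + 162 * v x i * big a) <= _).
  apply: (pE_mono (@half_ge0 _ _)) => a.
  have -> : big a = big a ^+ 2 by rewrite /big nat_bool_sqr.
  rewrite -subr_ge0.
  have -> : (648 * v x i)^-1 * X a ^+ 4 + 162 * v x i * big a ^+ 2 - X a ^+ 2 * big a ^+ 2 =
     (648 * v x i)^-1 * (X a ^+ 2 - 324 * v x i * big a) ^+ 2
     + X a ^+ 2 * (big a - big a ^+ 2).
    by field.
  have -> : big a - big a ^+ 2 = 0 by rewrite /big nat_bool_sqr subrr.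
  by rewrite mulr0 addr0; apply: mulr_ge0 (sqr_ge0 _).
rewrite /rE pED !pEZ -/(rE _) -/(rE _).
have := khintchine4 (e x i); rewrite -/(v x i).
have -> : (fun a : {ffun 'I_n -> bool} => (\sum_x0 sgb R (a x0) * e x i x0) ^+ 4) =
   fun a => X a ^+ 4 by apply: funext => a; rewrite /X ip_sketch_row.
move=> H4; apply: le_trans (_ : (648 * v x i)^-1 * (81 * v x i ^+ 2) + 162 * v x i * 1296^-1 <= _).
  by apply: lerD; [exact: ler_wpM2l k1 _ _ H4|exact: ler_wpM2l k2 _ _ big_le].
by rewrite le_eqVlt; apply/orP; left; apply/eqP; field.
Qed.

(** Markov's inequality for the potential of [Q a], which starts at the identity. Failure puts an
    eigenvalue below 1 + 1/4 = 5/4, while half the truncated means raise the identity to at least 1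
    + 3/8 = 11/8. The ratio (5/4)(8/11) is 10/11. *)
Theorem sketch_lower_tail :
  rE (fun a : {ffun 'I_m * 'I_n -> bool} =>
     (`[< exists x, \sum_i ip (sketch_row [ffun j => a (i, j)] i) x ^+ 2 < 4^-1 * nsq x >])%:R)
  <= r%:R * (10 / 11) ^+ p.+1 :> R.
Proof.
pose w (i : 'I_m) (t : {ffun 'I_n -> bool}) : R := \prod_(j : 'I_n) 2^-1.
have w0 i t : 0 <= w i t by apply: prodr_ge0 => j _; rewrite invr_ge0.
have w1 i : \sum_t w i t = 1 by exact: prod_half_sum1.
rewrite rE_curry -/w; pose y i t := truncated (sketch_row t i).
have yB i t : p.+2%:R * nsq (y i t) <= 2^-1 by exact: truncatedB.
have one_ge (x : 'cV[R]_r) : nsq x <= qform 1%:M x by rewrite qform1.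
pose Q (a : {ffun 'I_m -> {ffun 'I_n -> bool}}) := 1%:M + \sum_i y i (a i) *m (y i (a i))^T.
have Qs a : (Q a)^T = Q a.
  rewrite /Q linearD /= trmx1 linear_sum /=; congr (_ + _).
  by apply: eq_bigr => i _; rewrite sym_rank1.
have qQ a x : qform (Q a) x = nsq x + \sum_i ip (y i (a i)) x ^+ 2.
  rewrite qformD qform1 qform_sum; congr (_ + _); apply: eq_bigr => i _.
  by rewrite qform_rank1 -ipE.
have Q1 a x : 1 * nsq x <= qform (Q a) x.
  by rewrite mul1r qQ lerDl sumr_ge0 // => i _; rewrite sqr_ge0.
apply: le_trans (_ : pE w (fun a => (5 / 4) ^+ p.+1 * potential p.+1 (Q a)) <= _).
  apply: pE_mono => // a; case: asboolP => [[x Hx]|_]; last first.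
    rewrite mulr_ge0 ?exprn_ge0 ?divr_ge0 //.
    have [Z [l [ZZ QE lc QI]]] := pd_spectral (Qs a) ltr01 (Q1 a).
    rewrite /potential QI conjdiagX // tr_conjdiag // sumr_ge0 // => i _.
    by rewrite !mxE exprn_ge0 // invr_ge0 (le_trans ler01).
  have Qx : qform (Q a) x < 5 / 4 * nsq x.
    rewrite qQ; have : \sum_i ip (y i (a i)) x ^+ 2 < 4^-1 * nsq x; last by lra.
    apply: le_lt_trans Hx; apply: ler_sum => i _.
    apply: le_trans (ip_truncated_le _ _) _; rewrite le_eqVlt; apply/orP; left.
    apply/eqP; congr (ip (sketch_row _ _) _ ^+ 2).
    by apply/ffunP => j; rewrite !ffunE.
  have := potential_ge (Qs a) ltr01 (Q1 a) p.+1 Qx.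
  have c0 : 0 <= (5 / 4 : R) ^+ p.+1 by rewrite exprn_ge0 // divr_ge0.
  have E1 : (5 / 4 : R) / (5 / 4) = 1 by field.
  by move=> /(ler_wpM2l c0); rewrite -exprMn E1 expr1n.
rewrite pEZ.
have H := potential_rows w0 w1 yB (index_enum_uniq 'I_m) (trmx1 _ _) one_ge.
have -> : r%:R * (10 / 11) ^+ p.+1 = (5 / 4) ^+ p.+1 * (r%:R * (11 / 8)^-1 ^+ p.+1) :> R.
  by rewrite mulrCA -exprMn; congr (_ * _ ^+ _); field.
rewrite ler_wpM2l ?exprn_ge0 ?divr_ge0 //; apply: le_trans H _.
apply: potential_le; first 1 last; first by rewrite divr_gt0.
- move=> x; rewrite qformD qform1 qform_sum.
  have : 2^-1 * (3 / 4 * nsq x) <= \sum_i qform (2^-1 *: \sum_t w i t *: (y i t *m (y i t)^T)) x.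
    rewrite -sum_row_variance !mulr_sumr; apply: ler_sum => i _.
    rewrite qformZ ler_wpM2l ?invr_ge0 // qform_sum.
    apply: le_trans (truncated_variance i x) _; rewrite le_eqVlt; apply/orP; left.
    apply/eqP; apply: eq_bigr => t _; by rewrite qformZ qform_rank1 -ipE.
  lra.
- rewrite linearD /= trmx1 linear_sum /=; congr (_ + _).
  apply: eq_bigr => i _; rewrite linearZ /= linear_sum /=; congr (_ *: _).
  by apply: eq_bigr => t _; rewrite linearZ /= sym_rank1.
Qed.

End LowerTail.

(** * The cross term *)

Lemma sum_pair (V : nmodType) (I J : finType) (F : I * J -> V) :
  \sum_x F x = \sum_i \sum_j F (i, j).
Proof. by rewrite pair_bigA; apply: eq_bigr => -[]. Qed.

Section CrossTerm.
Variables (R : realType) (m n r s : nat) (u : 'I_n -> 'cV[R]_r) (z : 'I_n -> R).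
Hypotheses (s_gt0 : (0 < s)%N) (uz0 : \sum_j z j *: u j = 0).

Definition sketch_coord (b : 'I_n -> {ffun 'I_m -> bool}) (a : {ffun 'I_n -> bool}) i : R :=
  \sum_k sgb R (a k) * ((Num.sqrt s%:R)^-1 * (b k i)%:R * z k).

Definition row_of (a : {ffun 'I_m * 'I_n -> bool}) i : {ffun 'I_n -> bool} :=
  [ffun j => a (i, j)].

(** The vector U^T Phi^T Phi z, summed over the rows of the sketch. *)
Definition cross b (a : {ffun 'I_m * 'I_n -> bool}) : 'cV[R]_r :=
  \sum_i sketch_coord b (row_of a i) i *: sketch_row s u b (row_of a i) i.

Section FixedColumns.
Variable b : {ffun 'I_n -> {ffun 'I_m -> bool}}.
Hypothesis b_weight : forall j, (\sum_i b j i)%N = s.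

Definition chaos_coef (x y : 'I_m * 'I_n) : 'cV[R]_r :=
  if (x.1 == y.1) && (x.2 != y.2)
  then (s%:R^-1 * (b x.2 x.1 && b y.2 x.1)%:R * z y.2) *: u x.2 else 0.

(** The diagonal terms have squared signs, and since each column has [s] ones they add up to the sum
    of the [z j *: u j], which vanishes by orthogonality of the residual. *)
Lemma cross_chaos a :
  cross b a = \sum_x \sum_y (sgb R (a x) * sgb R (a y)) *: chaos_coef x y.
Proof.
pose T i j k : 'cV[R]_r := (sgb R (a (i, j)) * sgb R (a (i, k)) *
   (s%:R^-1 * (b j i && b k i)%:R * z k)) *: u j.
have -> : cross b a = \sum_i \sum_j \sum_k T i j k.
  apply: eq_bigr => i _; rewrite scaler_sumr; apply: eq_bigr => j _.
  rewrite !scalerA /sketch_coord !mulr_suml scaler_suml; apply: eq_bigr => k _.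
  rewrite /T !ffunE; congr (_ *: _).
  have -> : (b j i && b k i)%:R = (b j i)%:R * (b k i)%:R :> R by rewrite -natrM mulnb.
  by rewrite -(inv_sqrt_sqr R s); ring.
have -> : \sum_i \sum_j \sum_k T i j k = \sum_i \sum_j \sum_(k | k != j) T i j k.
  have diag : \sum_i \sum_j T i j j = 0.
    rewrite exchange_big -[RHS]uz0; apply: eq_bigr => j _ /=.
    rewrite -scaler_suml; congr (_ *: _).
    rewrite (eq_bigr (fun i => (b j i)%:R * (s%:R^-1 * z j))) => [|i _].
      rewrite -mulr_suml -natr_sum b_weight mulrA mulfV ?mul1r //.
      by rewrite pnatr_eq0 -lt0n.
    by rewrite sgb_sqr andbb; ring.
  transitivity (\sum_i \sum_j T i j j + \sum_i \sum_j \sum_(k | k != j) T i j k).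
    2: by rewrite diag add0r.
  rewrite -big_split; apply: eq_bigr => i _ /=.
  by rewrite -big_split; apply: eq_bigr => j _ /=; rewrite (bigD1 j).
rewrite sum_pair.
apply: eq_bigr => i _; apply: eq_bigr => j _.
rewrite sum_pair.
rewrite (bigD1 i) //= [X in _ + X]big1 => [|i' i'i]; last first.
  rewrite big1 // => k _.
  by rewrite /chaos_coef /= eq_sym (negbTE i'i) scaler0.
rewrite addr0 big_mkcond; apply: eq_bigr => k _.
rewrite /chaos_coef /= eqxx /= (eq_sym j); case: eqP => _ /=; first by rewrite scaler0.
by rewrite scalerA.
Qed.

Lemma chaos_coef_sum : \sum_x \sum_y nsq (chaos_coef x y) =
  s%:R^-1 ^+ 2 * \sum_k z k ^+ 2 * overlap (fun j => nsq (u j)) k b.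
Proof.
rewrite sum_pair.
pose V i j k : R := s%:R^-1 ^+ 2 * (z k ^+ 2 * (nsq (u j) * (b k i && b j i)%:R)).
transitivity (\sum_i \sum_j \sum_(k | k != j) V i j k).
  apply: eq_bigr => i _; apply: eq_bigr => j _.
  rewrite sum_pair.
  have n0 : nsq (0 : 'cV[R]_r) = 0 by rewrite -ipxx ip0l.
  rewrite (bigD1 i) //= [X in _ + X]big1 => [|i' i'i]; last first.
    by rewrite big1 // => k _; rewrite /chaos_coef /= eq_sym (negbTE i'i).
  rewrite addr0 [RHS]big_mkcond; apply: eq_bigr => k _.
  rewrite /chaos_coef /= eqxx /= (eq_sym j); case: eqP => _ //=.
  rewrite nsqZ !exprMn nat_bool_sqr /V [b k i && _]andbC; ring.
rewrite exchange_big /= mulr_sumr.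
have -> : \sum_k s%:R^-1 ^+ 2 * (z k ^+ 2 * overlap (fun j => nsq (u j)) k b) =
   \sum_k \sum_(j | j != k) \sum_i V i j k.
  apply: eq_bigr => k _; rewrite /overlap !mulr_sumr; apply: eq_bigr => j _.
  by rewrite !mulr_sumr.
rewrite [RHS](exchange_big_dep xpredT) //=; apply: eq_bigr => j _.
rewrite exchange_big /=.
by rewrite [RHS](eq_bigl (fun k => k != j)) // => k; rewrite eq_sym.
Qed.

Lemma cross_moment p : rE (fun a => nsq (cross b a) ^+ p.+1) <=
  ((4 * p.+1%:R + 1) ^+ 2 * (2 * (s%:R^-1 ^+ 2 *
     \sum_k z k ^+ 2 * overlap (fun j => nsq (u j)) k b))) ^+ p.+1.
Proof.
rewrite -chaos_coef_sum.
have -> : (fun a => nsq (cross b a) ^+ p.+1) = (fun a => nsq (\sum_x \sum_y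
   (sgb R (a x) * sgb R (a y)) *: chaos_coef x y) ^+ p.+1).
  by apply: funext => a; rewrite cross_chaos.
by apply: chaos2_moment => x; rewrite /chaos_coef !eqxx.
Qed.

End FixedColumns.

Section RandomColumns.
Variable q : 'I_n -> {ffun 'I_m -> bool} -> R.
Hypotheses (q0 : forall j t, 0 <= q j t) (q1 : forall j, \sum_t q j t = 1).
Hypothesis q_weight : forall j t, q j t != 0 -> (\sum_i t i)%N = s.
Hypothesis q_moment : forall j (I : {set 'I_m}),
  \sum_t q j t * \prod_(i in I) (t i)%:R <= (s%:R / m%:R) ^+ #|I|.
Variables (M d Q t : R) (p : nat).
Hypotheses (uM : forall j, nsq (u j) <= M) (ud : \sum_j nsq (u j) = d).
Hypotheses (Q0 : 0 < Q) (QM : 2 * (p.+1%:R * M) <= Q)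
  (Qd : 2 * (s%:R * (s%:R / m%:R) * d) <= Q).
Hypothesis t0 : 0 < t.
Let N := \sum_k z k ^+ 2.
Hypothesis N0 : 0 < N.

(** Markov's inequality for the power [p.+1]. Given the columns, [cross_moment] bounds it by a power
    of a weighted mean of overlaps; Jensen with weights [z k ^+ 2 / N] moves the power onto single
    overlaps, where [overlap_moment] applies. *)
Theorem cross_tail :
  pE q (fun b => rE (fun a => (t * N < nsq (cross b a))%R%:R)) <=
  (2 * (4 * p.+1%:R + 1) ^+ 2 * (expR 1 * Q) / (t * s%:R ^+ 2)) ^+ p.+1.
Proof.
pose K : R := 4 * p.+1%:R + 1.
pose ov k (b : {ffun 'I_n -> {ffun 'I_m -> bool}}) := overlap (fun j => nsq (u j)) k b.
pose c : R := (2 * K ^+ 2 / (t * s%:R ^+ 2)) ^+ p.+1.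
have tN : 0 < t * N by rewrite mulr_gt0.
have s0 : 0 < s%:R :> R by rewrite ltr0n.
have c0 : 0 <= c.
  rewrite exprn_ge0 // divr_ge0 // mulr_ge0 ?sqr_ge0 //; exact: ltW.
have ov0 k b : 0 <= ov k b.
  by apply: sumr_ge0 => j _; rewrite mulr_ge0 ?nsq_ge0 // sumr_ge0.
apply: le_trans (_ : pE q (fun b => c * \sum_k (z k ^+ 2 / N) * ov k b ^+ p.+1) <= _).
  apply: pE_mono_supp => // b bq.
  have bw j : (\sum_i b j i)%N = s by apply: q_weight (bq j).
  apply: le_trans (_ : rE (fun a => (t * N) ^- p.+1 * nsq (cross b a) ^+ p.+1) <= _).
    apply: (pE_mono (@half_ge0 _ _)) => a; case: ltP => H /=; last first.
      by rewrite mulr_ge0 ?invr_ge0 ?exprn_ge0 ?nsq_ge0 // ltW.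
    rewrite mulrC ler_pdivlMr ?exprn_gt0 // mul1r lerXn2r ?nnegrE ?nsq_ge0 //; exact: ltW.
  rewrite /rE pEZ -/(rE _).
  have i0 : 0 <= (t * N) ^- p.+1 by rewrite invr_ge0 exprn_ge0 // ltW.
  apply: le_trans (ler_wpM2l i0 (cross_moment bw p)) _.
  have -> : (t * N) ^- p.+1 * (K ^+ 2 * (2 * (s%:R^-1 ^+ 2 * \sum_k z k ^+ 2 * ov k b))) ^+ p.+1
      = c * (\sum_k (z k ^+ 2 / N) * ov k b) ^+ p.+1.
    rewrite -exprVn /c -!exprMn; congr (_ ^+ _).
    have -> : \sum_k z k ^+ 2 / N * ov k b = (\sum_k z k ^+ 2 * ov k b) / N.
      by rewrite mulr_suml; apply: eq_bigr => k _; rewrite mulrAC.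
    by field; rewrite !gt_eqF.
  apply: (ler_wpM2l c0); apply: jensen_pow => [k||k] //.
    by rewrite divr_ge0 ?sqr_ge0 // ltW.
  by rewrite -mulr_suml divff // gt_eqF.
rewrite pEZ pE_sum.
have -> : (2 * K ^+ 2 * (expR 1 * Q) / (t * s%:R ^+ 2)) ^+ p.+1 = c * (expR 1 * Q) ^+ p.+1.
  by rewrite /c -exprMn; congr (_ ^+ _); rewrite mulrAC.
apply: (ler_wpM2l c0).
have -> : (expR 1 * Q) ^+ p.+1 = \sum_k z k ^+ 2 / N * (expR 1 * Q) ^+ p.+1.
  by rewrite -!mulr_suml divff ?mul1r // gt_eqF.
apply: ler_sum => k _; rewrite pEZ ler_wpM2l //.
  by rewrite divr_ge0 ?sqr_ge0 // ltW.
apply: (overlap_moment q0 q1 q_weight q_moment _ uM ud _ Q0 QM Qd) => j.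
exact: nsq_ge0.
Qed.

End RandomColumns.
End CrossTerm.

(** * Both failure probabilities combined *)

Section Constants.
Variable R : realType.

Lemma expR1_le4 : expR 1 <= 4 :> R.
Proof.
have h0 : 0 <= 2^-1 :> R by rewrite invr_ge0.
have -> : (1 : R) = 2%:R * 2^-1 by field.
have := expR_le_double h0 (lexx _); rewrite expRM_natl expr2 => H.
have e0 := expR_ge0 (2^-1 : R).
have H2 : expR (2^-1) <= 2 :> R by lra.
have := ler_pM e0 e0 H2 H2; lra.
Qed.

Lemma ten_elevenths_le : 10 / 11 <= expR (- 11^-1) :> R.
Proof. by have := expR_ge1Dx (- 11^-1 : R); lra. Qed.

(** 44 = 4 * 11: eleven factors 10/11 give at most exp(-1). *)
Lemma geometric_le (L : R) p : 44 * L <= p.+1%:R ->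
  (10 / 11) ^+ p.+1 <= expR (- (4 * L)).
Proof.
move=> pL; apply: le_trans (_ : expR (- 11^-1) ^+ p.+1 <= _).
  by rewrite lerXn2r ?nnegrE ?expR_ge0 ?divr_ge0 // ten_elevenths_le.
by rewrite -expRM_natl ler_expR; lra.
Qed.

(** Adds up the three failure probabilities, each at most the cube of the target. *)
Lemma three_cubes_le (x : R) : 0 < x -> x <= 2^-1 -> x ^+ 3 + (x ^+ 3 + x ^+ 3) <= x.
Proof.
move=> x0 x2; have x3 : x ^+ 3 <= 4^-1 * x.
  have -> : x ^+ 3 = x * x * x by ring.
  rewrite ler_wpM2r ?(ltW x0) //.
  have -> : 4^-1 = 2^-1 * 2^-1 :> R by field.
  by rewrite ler_pM // ltW.
lra.
Qed.

Lemma ceil_nat (x : R) : 0 < x -> exists p : nat, x <= p.+1%:R /\ p.+1%:R <= x + 1.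
Proof.
move=> x0; exists (Num.truncn x); split.
  by rewrite ltW // truncnS_gt.
by rewrite -natr1 lerD2r truncn_le ltW.
Qed.

(** The exponent of [row_mass_tail] at [l = (2 * M)^-1] and threshold [s / P]. The mean term is at
    most a quarter of the threshold term, and what remains is at least [8 * L * M]. *)
Lemma row_tail_exponent (L M s m r P : R) : 2^-1 <= L -> 0 < M -> 0 < m -> 0 < s ->
  0 <= r -> 0 < P -> 8 * P <= 10 ^+ 6 * L ->
  10 ^+ 6 * (L * r) <= m -> 2 * 10 ^+ 6 * (M * L ^+ 2) <= s ->
  2 * (s / m) * ((2 * M)^-1 * r) - (2 * M)^-1 * (s / P) <= - (4 * L).
Proof.
move=> L2 M0 m0 s0 r0 P0 PL Hm Hs.
have L0 : 0 < L by lra.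
have Lr0 : 0 <= L * r by rewrite mulr_ge0 // ltW.
have E1 : (s / m) * r <= s / L / 10 ^+ 6.
  have -> : s / L / 10 ^+ 6 = (s / m) * (m / L / 10 ^+ 6) by field; rewrite !gt_eqF.
  by rewrite ler_wpM2l ?divr_ge0 ?(ltW s0) ?(ltW m0) // !ler_pdivlMr ?exprn_gt0 //; lra.
have E2 : 8 * (s / L / 10 ^+ 6) <= s / P.
  have -> : 8 * (s / L / 10 ^+ 6) = s * (8 / (10 ^+ 6 * L)) by field; rewrite !gt_eqF.
  rewrite ler_pM2l // ler_pdivrMr ?mulr_gt0 ?exprn_gt0 //.
  by rewrite mulrC ler_pdivlMr.
have E3 : 2 * 10 ^+ 6 * (M * L) <= s / L.
  by rewrite ler_pdivlMr //; lra.
have i0 : 0 < (2 * M)^-1 by rewrite invr_gt0 mulr_gt0.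
have -> : 2 * (s / m) * ((2 * M)^-1 * r) - (2 * M)^-1 * (s / P) =
   (2 * M)^-1 * (2 * ((s / m) * r) - s / P) by ring.
apply: le_trans (_ : (2 * M)^-1 * (- (8 * L * M)) <= _).
  rewrite ler_wpM2l ?(ltW i0) //.
  have ML : 0 <= M * L by rewrite mulr_ge0 // ltW.
  have E4 : 2 * (M * L) <= s / L / 10 ^+ 6.
    by rewrite ler_pdivlMr ?exprn_gt0 //; lra.
  lra.
by rewrite le_eqVlt; apply/orP; left; apply/eqP; field; rewrite gt_eqF.
Qed.

Lemma cross_tail_base (L M s m r e k : R) : 2^-1 <= L -> 0 <= M -> 0 < m -> 0 < s ->
  0 <= r -> 0 < e -> 0 <= k -> k <= 3 * L ->
  10 ^+ 7 * (L ^+ 2 * r) <= e * m -> 10 ^+ 7 * (M * L ^+ 3) <= e * s ^+ 2 ->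
  2 * (4 * k + 1) ^+ 2 * (expR 1 * (2 * (k * M) + 2 * (s * (s / m) * r))) / (e / 8 * s ^+ 2)
  <= expR (- 3).
Proof.
move=> L2 M0 m0 s0 r0 e0 k0 kL Hm Hs.
have L0 : 0 <= L by lra.
have s20 : 0 < s ^+ 2 by rewrite exprn_gt0.
(* [4 * k + 1] is at most [12 * L + 2 * L], since [2^-1 <= L]. *)
have K2 : (4 * k + 1) ^+ 2 <= 196 * L ^+ 2.
  have -> : 196 * L ^+ 2 = (14 * L) ^+ 2 by ring.
  by rewrite lerXn2r ?nnegrE; lra.
have kM : k * M <= 3 * L * M by rewrite ler_wpM2r.
set X := s * (s / m) * r; have X0 : 0 <= X.
  by apply: mulr_ge0 => //; apply: mulr_ge0; rewrite ?divr_ge0 ?(ltW s0) ?(ltW m0).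
have XL : 10 ^+ 7 * (L ^+ 2 * X) <= e * s ^+ 2.
  have -> : 10 ^+ 7 * (L ^+ 2 * X) = (s ^+ 2 / m) * (10 ^+ 7 * (L ^+ 2 * r)).
    by rewrite /X; field; rewrite gt_eqF.
  have -> : e * s ^+ 2 = (s ^+ 2 / m) * (e * m) by field; rewrite gt_eqF.
  by rewrite ler_wpM2l // divr_ge0 // ltW.
have es0 : 0 < e / 8 * s ^+ 2 by rewrite !mulr_gt0 // invr_gt0.
rewrite expRN ler_pdivrMr //.
have E0 := expR_gt0 (1 : R).
have -> : expR 3 = expR 1 ^+ 3 :> R by rewrite -expRM_natl mulr1.
set E := expR 1 in E0 *.
have E4 : E ^+ 4 <= 256.
  have -> : 256 = 4 ^+ 4 :> R by ring.
  by rewrite lerXn2r ?nnegrE ?expR1_le4 //; exact: ltW.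
rewrite [leRHS]mulrC ler_pdivlMr ?exprn_gt0 //.
have -> : 2 * (4 * k + 1) ^+ 2 * (E * (2 * (k * M) + 2 * X)) * E ^+ 3 =
   E ^+ 4 * (4 * (4 * k + 1) ^+ 2 * (k * M + X)) by ring.
have kMX : 0 <= k * M + X by rewrite addr_ge0 // mulr_ge0.
apply: le_trans (_ : 256 * (4 * (196 * L ^+ 2) * (3 * L * M + X)) <= _).
  apply: ler_pM => //.
  - by rewrite exprn_ge0 // ltW.
  - by apply: mulr_ge0 => //; apply: mulr_ge0 => //; exact: sqr_ge0.
  - apply: ler_pM => //.
    + by apply: mulr_ge0 => //; exact: sqr_ge0.
    + lra.
    + lra.
have -> : 256 * (4 * (196 * L ^+ 2) * (3 * L * M + X)) =
  768 * 784 * (M * L ^+ 3) + 256 * 784 * (L ^+ 2 * X) by ring.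
lra.
Qed.

End Constants.

Lemma natr_boolU_le (R : realType) (x y z : bool) : (x -> y || z) ->
  x%:R <= y%:R + z%:R :> R.
Proof.
case: x => [/(_ isT)|_]; last by rewrite addr_ge0.
by case: y => /= [_|->]; rewrite ?add0r // lerDl.
Qed.

Section FiniteSketch.
Variables (R : realType) (m n r s : nat) (u : 'I_n -> 'cV[R]_r) (z : 'I_n -> R).
Variable q : 'I_n -> {ffun 'I_m -> bool} -> R.
Hypotheses (q0 : forall j t, 0 <= q j t) (q1 : forall j, \sum_t q j t = 1).
Hypothesis q_weight : forall j t, q j t != 0 -> (\sum_i t i)%N = s.
Hypothesis q_moment : forall j (I : {set 'I_m}),
  \sum_t q j t * \prod_(i in I) (t i)%:R <= (s%:R / m%:R) ^+ #|I|.
Hypotheses (u_frame : \sum_j u j *m (u j)^T = 1%:M) (uz0 : \sum_j z j *: u j = 0).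
Variables (M L e : R).
Hypotheses (m_gt0 : (0 < m)%N) (s_gt0 : (0 < s)%N).
Hypotheses (uM : forall j, nsq (u j) <= M) (M_gt0 : 0 < M) (e_gt0 : 0 < e) (e_le : e <= 2^-1).
Hypotheses (L_ge : 2 <= expR L) (mL : m%:R <= expR L).
Hypothesis Hm : 10 ^+ 7 * (L ^+ 2 * r%:R) <= e * m%:R.
Hypothesis Hs1 : 10 ^+ 7 * (M * L ^+ 2) <= e * s%:R.
Hypothesis Hs2 : 10 ^+ 7 * (M * L ^+ 3) <= e * s%:R ^+ 2.

Definition lower_fail (b : {ffun 'I_n -> {ffun 'I_m -> bool}}) (a : {ffun 'I_m * 'I_n -> bool}) : bool :=
  `[< exists x, \sum_i ip (sketch_row s u b (row_of a i) i) x ^+ 2 < 4^-1 * nsq x >].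

Definition cross_fail (b : {ffun 'I_n -> {ffun 'I_m -> bool}}) (a : {ffun 'I_m * 'I_n -> bool}) : bool :=
  e / 8 * (\sum_k z k ^+ 2) < nsq (cross s u z b a).

Lemma sum_nsq_frame : \sum_j nsq (u j) = r%:R.
Proof.
rewrite -mxtrace1 -u_frame linear_sum; apply: eq_bigr => j _ /=.
by rewrite nsqE mxtrace_mulC /mxtrace big_ord1.
Qed.

Let eta := expR (- L).

Let L_half : 2^-1 <= L.
Proof.
rewrite leNgt; apply/negP => L2.
have h0 : 0 <= 2^-1 :> R by rewrite invr_ge0.
have : expR L < expR 2^-1 by rewrite ltr_expR.
by have := expR_le_double h0 (lexx _); have := L_ge; lra.
Qed.

Let eta_gt0 : 0 < eta. Proof. exact: expR_gt0. Qed.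

Let eta_le : eta <= 2^-1.
Proof.
by rewrite /eta expRN lef_pV2 ?posrE // expR_gt0.
Qed.

Let m_eta : m%:R * eta <= 1.
Proof. by rewrite /eta expRN ler_pdivrMr ?expR_gt0 // mul1r. Qed.

Let r_le_m : r%:R <= m%:R :> R.
Proof.
have LL : 2^-1 * 2^-1 <= L * L by rewrite ler_pM // invr_ge0.
have m0 : 0 <= m%:R :> R by [].
have em : e * m%:R <= 2^-1 * m%:R by rewrite ler_wpM2r.
have rr : 2^-1 * 2^-1 * r%:R <= L * L * r%:R by rewrite ler_wpM2r.
have r0 : 0 <= r%:R :> R by [].
by have := Hm; rewrite expr2; lra.
Qed.

Let exp4 : expR (- (4 * L)) = eta ^+ 4.
Proof. by rewrite -expRM_natl mulrN. Qed.

(** Each row is heavy with probability at most [eta ^+ 4]; the union over [m] rows costs one factor,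
    as [m%:R * eta <= 1]. *)
Lemma heavy_row_prob (P : R) : 0 < P -> 8 * P <= 10 ^+ 6 * L ->
  pE q (fun b => (\sum_i (s%:R / P < row_mass u b i)%R%:R)) <= eta ^+ 3.
Proof.
move=> P0 PL; rewrite pE_sum.
apply: le_trans (_ : \sum_(i < m) eta ^+ 4 <= _).
  apply: ler_sum => i _.
  have l0 : 0 <= (2 * M)^-1 by rewrite invr_ge0 mulr_ge0 // ltW.
  have lM : (2 * M)^-1 * M <= 2^-1.
    by rewrite le_eqVlt; apply/orP; left; apply/eqP; field; rewrite gt_eqF.
  have nsq0 j : 0 <= nsq (u j) by exact: nsq_ge0.
  apply: le_trans (row_mass_tail q0 q_moment nsq0 uM sum_nsq_frame i _ l0 lM) _.
  rewrite -exp4 ler_expR; apply: row_tail_exponent => //; rewrite ?ltr0n //.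
    have Lr0 : 0 <= L ^+ 2 * r%:R by rewrite mulr_ge0 // exprn_ge0 //; have := L_half; lra.
    have m0 : 0 <= m%:R :> R by [].
    have em : e * m%:R <= 2^-1 * m%:R by rewrite ler_wpM2r.
    have : 2^-1 * (L * r%:R) <= L * (L * r%:R) by have LH := L_half; rewrite ler_wpM2r // mulr_ge0 //; lra.
    have := Hm; rewrite expr2; lra.
  have ML0 : 0 <= M * L ^+ 2 by rewrite mulr_ge0 ?sqr_ge0 // ltW.
  have s0 : 0 <= s%:R :> R by [].
  have es : e * s%:R <= 2^-1 * s%:R by rewrite ler_wpM2r.
  have := Hs1; lra.
rewrite sumr_const card_ord -[_ *+ _]mulr_natl (exprS eta 3) mulrA.
by rewrite -[leRHS]mul1r ler_wpM2r // exprn_ge0 // ltW.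
Qed.

Theorem sketch_fail_prob :
  pE q (fun b => rE (fun a => (lower_fail b a || cross_fail b a)%:R)) <= eta.
Proof.
have L0 : 0 < L by have := L_half; lra.
(* This [p] makes the geometric factor at most [eta ^+ 4], one power of which absorbs the dimension
   [r]. The exponent [k.+1] chosen next turns a base of at most exp(-3) into [eta ^+ 3]. *)
have [p [pL pU]] : exists p : nat, 44 * L <= p.+1%:R /\ p.+1%:R <= 44 * L + 1.
  by apply: ceil_nat; rewrite mulr_gt0.
have [k [kL kU]] := ceil_nat L0.
have k3 : k.+1%:R <= 3 * L by have := L_half; lra.
pose P : R := 2592 * p.+2%:R.
have P0 : 0 < P by apply: mulr_gt0; rewrite ltr0n.
(* [p.+2] is at most [44 * L + 2 <= 48 * L], and 8 * 2592 * 48 is below one million. *)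
have PL : 8 * P <= 10 ^+ 6 * L.
  by rewrite /P -[p.+2%:R]natr1; have := L_half; lra.
have h0 i c := @half_ge0 R ('I_m * 'I_n)%type i c.
have etapow (i : nat) (x : R) : L <= x -> expR (- (i%:R * x)) <= eta ^+ i.
  by move=> Lx; rewrite -expRM_natl mulrN ler_expR lerN2 ler_wpM2l.
(* If some row is heavy, the first sum is at least 1 and dominates any probability. Otherwise
   [sketch_lower_tail] applies conditionally on the columns. *)
apply: le_trans (_ : pE q (fun b => (\sum_i (s%:R / P < row_mass u b i)%R%:R) +
   (r%:R * (10 / 11) ^+ p.+1 + rE (fun a => (cross_fail b a)%:R))) <= _).
  apply: pE_mono_supp => // b bq.
  have bw j : (\sum_i b j i)%N = s by apply: q_weight (bq j).
  have c0 : 0 <= rE (fun a => (cross_fail b a)%:R) :> R.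
    by apply: (pE_ge0 h0).
  have rp0 : 0 <= r%:R * (10 / 11) ^+ p.+1 :> R by rewrite mulr_ge0 // exprn_ge0 // divr_ge0.
  have [light|/existsNP[i /negP]] := pselect (forall i, row_mass u b i <= s%:R / P).
    apply: le_trans (_ : rE (fun a => (lower_fail b a)%:R + (cross_fail b a)%:R) <= _).
      by apply: (pE_mono h0) => a; apply: natr_boolU_le.
    rewrite /rE pED -/(rE _) -/(rE _) -[leLHS]add0r; apply: lerD.
      by apply: sumr_ge0 => i _.
    by rewrite lerD2r; exact: sketch_lower_tail.
  rewrite -ltNge => heavy; apply: le_trans (_ : 1 <= _).
    rewrite -[leRHS](pE_cst (@half_sum1 R ('I_m * 'I_n)%type)).
    by apply: (pE_mono h0) => a; case: (_ || _).
  rewrite (bigD1 i) //= heavy -addrA lerDl addr_ge0 //; last by rewrite addr_ge0.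
  by apply: sumr_ge0.
rewrite pED.
have H2 : r%:R * (10 / 11) ^+ p.+1 <= eta ^+ 3.
  have : (10 / 11) ^+ p.+1 <= eta ^+ 4 by rewrite -exp4 geometric_le.
  move=> H; apply: le_trans (_ : r%:R * eta ^+ 4 <= _); first by rewrite ler_wpM2l.
  rewrite (exprS eta 3) mulrA -[leRHS]mul1r ler_wpM2r ?exprn_ge0 ?(ltW eta_gt0) //.
  by apply: le_trans m_eta; rewrite ler_wpM2r // ltW.
have H3 : pE q (fun b => rE (fun a => (cross_fail b a)%:R)) <= eta ^+ 3.
  pose N := \sum_k z k ^+ 2; have N0 : 0 <= N by apply: sumr_ge0 => j _; exact: sqr_ge0.
  (* [cross_tail] divides by [N]. When [N = 0] the residual and the cross term vanish, and the
     strict inequality in [cross_fail] never holds. *)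
  move: N0; rewrite le0r => /predU1P[Nz|N0].
    rewrite (@eq_pE _ _ _ _ _ (fun=> 0)) ?pE_cst ?exprn_ge0 // ?(ltW eta_gt0) // => b.
    rewrite -[RHS](pE_cst (@half_sum1 R ('I_m * 'I_n)%type)); apply: eq_pE => a.
    have z0 j : z j = 0.
      apply/eqP; rewrite -sqrf_eq0; apply/eqP; apply: (psumr_eq0P _ Nz) => // i _.
      exact: sqr_ge0.
    rewrite /cross_fail -/N Nz mulr0 (_ : cross s u z b a = 0) -?ipxx ?ip0l ?ltxx //.
    rewrite /cross big1 // => i _; rewrite /sketch_coord big1 ?scale0r // => j _.
    by rewrite z0 !mulr0.
  have e8 : 0 < e / 8 by rewrite divr_gt0.
  pose Q := 2 * (k.+1%:R * M) + 2 * (s%:R * (s%:R / m%:R) * r%:R).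
  have sr0 : 0 <= s%:R * (s%:R / m%:R) * r%:R :> R.
    by apply: mulr_ge0 => //; apply: mulr_ge0 => //; rewrite divr_ge0.
  have kM0 : 0 < k.+1%:R * M by rewrite mulr_gt0 // ltr0n.
  have Q0 : 0 < Q by rewrite /Q ltr_wpDr ?mulr_ge0 // mulr_gt0.
  have QM : 2 * (k.+1%:R * M) <= Q by rewrite /Q lerDl mulr_ge0.
  have Qd : 2 * (s%:R * (s%:R / m%:R) * r%:R) <= Q by rewrite /Q lerDr mulr_ge0 // ltW.
  apply: le_trans (cross_tail s_gt0 uz0 q0 q1 q_weight q_moment uM sum_nsq_frame Q0 QM Qd e8 N0) _.
  apply: le_trans (_ : expR (- 3) ^+ k.+1 <= _).
    rewrite lerXn2r ?nnegrE ?expR_ge0 //.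
      apply: divr_ge0; last by apply: mulr_ge0 (ltW e8) (sqr_ge0 _).
      apply: mulr_ge0; last by apply: mulr_ge0 (expR_ge0 _) (ltW Q0).
      by apply: mulr_ge0 (sqr_ge0 _).
    apply: (@cross_tail_base _ L) => //; rewrite ?ltr0n ?(ltW M_gt0) //.
  rewrite -expRM_natl mulrN mulrC; exact: (etapow 3).
rewrite pED pE_cst //.
have H1 := heavy_row_prob P0 PL.
exact: le_trans (lerD H1 (lerD H2 H3)) (three_cubes_le eta_gt0 eta_le).
Qed.

End FiniteSketch.

(** * Reduction to finite sums *)

Lemma eq1N1 (F : numDomainType) : (1 == -1 :> F) = false.
Proof. by rewrite gt_eqF // (lt_trans (ltrN10 F) ltr01). Qed.

Section FiniteValued.
Local Open Scope classical_set_scope.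
Context {d : measure_display} {T : measurableType d} {R : realType}.
Variable P : probability T R.

Lemma prob_mem_seq (K : finType) (X : T -> K) (s : seq K) :
  (forall k, measurable [set w | X w = k]) -> uniq s ->
  measurable [set w | X w \in s] /\
  P [set w | X w \in s] = (\sum_(k <- s) fine (P [set w | X w = k]))%:E.
Proof.
move=> mX; elim: s => [_|k s IH /= /andP[ks us]].
  rewrite big_nil (_ : [set w | _] = set0) ?measure0 //.
  by apply/seteqP; split.
have [ms Ps] := IH us.
have -> : [set w | X w \in k :: s] = [set w | X w = k] `|` [set w | X w \in s].
  apply/seteqP; split=> w /=; rewrite inE.
    by case/predU1P; [left|right].
  by case=> [->|->]; rewrite ?eqxx ?orbT.
split; first exact: measurableU.
rewrite (measureU P) //; last first.
  by apply/seteqP; split => // w /= [->]; rewrite (negbTE ks).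
rewrite big_cons EFinD fineK ?fin_num_measure //; congr (_ + _)%E; exact: Ps.
Qed.

Lemma prob_finite_valued (K : finType) (X : T -> K) (G : pred K) :
  (forall k, measurable [set w | X w = k]) ->
  P [set w | G (X w)] = (\sum_(k | G k) fine (P [set w | X w = k]))%:E.
Proof.
move=> mX; have -> : \sum_(k | G k) fine (P [set w | X w = k]) =
    \sum_(k <- enum G) fine (P [set w | X w = k]) by rewrite big_enum.
have [_ <-] := prob_mem_seq mX (enum_uniq G).
by congr (P _); apply/seteqP; split=> w /=; rewrite mem_enum.
Qed.

Lemma sigma_generated_bigcap (J I : finType) (X : J -> {RV P >-> R}) (E : I -> set T) :
  (forall i, sigma_generated X (E i)) -> sigma_generated X (\bigcap_i E i).
Proof.
move=> XE; apply: (@fin_bigcap_measurable _ (g_sigma_algebraType _)) => //.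
by move=> i _; exact: XE.
Qed.

Lemma sigma_generated_level (J : Type) (X : J -> {RV P >-> R}) j (v : R) :
  sigma_generated X [set w | X j w = v].
Proof.
apply: sub_sigma_algebra; exists j => //; exists [set v] => //.
by rewrite setTI.
Qed.

End FiniteValued.

Section Bridge.
Local Open Scope classical_set_scope.
Context {d : measure_display} {T : measurableType d} {R : realType}.
Variables (P : probability T R) (m n s : nat).
Variables sigma delta : 'I_m -> 'I_n -> {RV P >-> R}.
Hypothesis H : sjlt_variables s sigma delta.

Definition signs w : {ffun 'I_m * 'I_n -> bool} :=
  [ffun p => sigma p.1 p.2 w == -1].

Definition columns w : {ffun 'I_n -> {ffun 'I_m -> bool}} :=
  [ffun j => [ffun i => delta i j w == 1]].

Definition column_mass j t : R := fine (P [set w | columns w j = t]).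

Lemma signsE w i j : sigma i j w = sgb R (signs w (i, j)).
Proof.
rewrite ffunE /=; have [/(_ w)[->|->] _ _] := sigma_rademacher H i j.
  by rewrite eq1N1.
by rewrite eqxx /sgb expr1.
Qed.

Lemma columnsE w i j : delta i j w = (columns w j i)%:R.
Proof.
rewrite !ffunE; have [->|->] := delta_01 H i j w; last by rewrite eqxx.
by rewrite eq_sym oner_eq0.
Qed.

Lemma signs_level (a : {ffun 'I_m * 'I_n -> bool}) :
  [set w | signs w = a] = \bigcap_p [set w | sigma p.1 p.2 w = sgb R (a p)].
Proof.
apply/seteqP; split=> w /= => [wa [i j] _ /=|wa]; first by rewrite signsE wa.
apply/ffunP => -[i j]; have /= := wa (i, j) I; rewrite signsE.
case: (signs w _) (a _) => -[] //; rewrite /sgb expr0 expr1 => /eqP.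
  by rewrite eq_sym eq1N1.
by rewrite eq1N1.
Qed.

Lemma column_level j t :
  [set w | columns w j = t] = \bigcap_i [set w | delta i j w = (t i)%:R].
Proof.
apply/seteqP; split=> w /= => [wt i _ /=|wt]; first by rewrite columnsE wt.
apply/ffunP => i; have /= := wt i I; rewrite columnsE => /eqP.
by rewrite eqr_nat; case: (columns w j i) (t i) => -[].
Qed.

Lemma columns_level b :
  [set w | columns w = b] = \bigcap_j [set w | columns w j = b j].
Proof.
apply/seteqP; split=> w /= => [wb j _ /=|wb]; first by rewrite wb.
by apply/ffunP => j; exact: wb.
Qed.

Lemma measurable_level (X : {RV P >-> R}) v : measurable [set w | X w = v].
Proof.
rewrite (_ : [set w | _] = setT `&` X @^-1` [set v]); last by rewrite setTI.
exact: measurable_funP.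
Qed.

Lemma measurable_signs a : measurable [set w | signs w = a].
Proof.
rewrite signs_level; apply: fin_bigcap_measurable => [|p _]; first exact: finite_finset.
exact: measurable_level.
Qed.

Lemma measurable_column j t : measurable [set w | columns w j = t].
Proof.
rewrite column_level; apply: fin_bigcap_measurable => [|p _]; first exact: finite_finset.
exact: measurable_level.
Qed.

Lemma measurable_columns b : measurable [set w | columns w = b].
Proof.
rewrite columns_level; apply: fin_bigcap_measurable => [|p _]; first exact: finite_finset.
exact: measurable_column.
Qed.

Lemma prob_signs a : P [set w | signs w = a] = (\prod_(p : 'I_m * 'I_n) (2^-1 : R))%:E.
Proof.
rewrite signs_level; have := sigma_independent H.
move=> /(_ [set: 'I_m * 'I_n]%SET (fun p => [set w | sigma p.1 p.2 w = sgb R (a p)])).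
have -> : [set j | j \in [set: 'I_m * 'I_n]%SET] = setT.
  by apply/seteqP; split => p //=; rewrite inE.
move=> -> => [|p _]; last first.
  exact: (@sigma_generated_level _ _ _ P unit (fun _ => sigma p.1 p.2) tt).
rewrite -prodEFin; apply: eq_big => [p|p _]; first by rewrite inE.
have [_ P1 PN1] := sigma_rademacher H p.1 p.2.
by case: (a p); rewrite /sgb ?expr0 ?expr1.
Qed.

Lemma prob_columns b : P [set w | columns w = b] = (\prod_j column_mass j (b j))%:E.
Proof.
rewrite columns_level; have := delta_columns_independent H.
move=> /(_ [set: 'I_n]%SET (fun j => [set w | columns w j = b j])).
have -> : [set j | j \in [set: 'I_n]%SET] = setT.
  by apply/seteqP; split => p //=; rewrite inE.
move=> -> => [|j _]; last first.
  rewrite column_level; apply: sigma_generated_bigcap => i.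
  exact: (@sigma_generated_level _ _ _ P _ (fun i => delta i j) i (b j i)%:R).
rewrite -prodEFin; apply: eq_big => [p|j _]; first by rewrite inE.
by rewrite fineK ?fin_num_measure //; exact: measurable_column.
Qed.

Lemma prob_joint b a : P [set w | (columns w, signs w) = (b, a)] =
  ((\prod_j column_mass j (b j)) * \prod_(p : 'I_m * 'I_n) 2^-1)%:E.
Proof.
rewrite (_ : [set w | _] = [set w | columns w = b] `&` [set w | signs w = a]).
  rewrite (delta_sigma_independent H) ?prob_columns ?prob_signs ?EFinM //.
    rewrite columns_level; apply: sigma_generated_bigcap => j.
    rewrite column_level; apply: sigma_generated_bigcap => i.
    exact: (@sigma_generated_level _ _ _ P _ (fun ij : 'I_m * 'I_n => delta ij.1 ij.2) (i, j) (b j i)%:R).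
  rewrite signs_level; apply: sigma_generated_bigcap => ij.
  exact: (@sigma_generated_level _ _ _ P _ (fun ij : 'I_m * 'I_n => sigma ij.1 ij.2) ij (sgb R (a ij))).
by apply/seteqP; split=> w /= [-> ->].
Qed.

(** Columns and signs take finitely many values and their joint law is a product, so any event they
    determine is a finite sum in which the signs are averaged given the columns. *)
Theorem prob_sketch_event (G : {ffun 'I_n -> {ffun 'I_m -> bool}} ->
    {ffun 'I_m * 'I_n -> bool} -> bool) :
  P [set w | G (columns w) (signs w)] =
  (pE column_mass (fun b => rE (fun a => (G b a)%:R)))%:E.
Proof.
have mX k : measurable [set w | (columns w, signs w) = k].
  case: k => b a.
  rewrite (_ : [set w | _] = [set w | columns w = b] `&` [set w | signs w = a]).
    by apply: measurableI; [exact: measurable_columns|exact: measurable_signs].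
  by apply/seteqP; split=> w /= [-> ->].
rewrite (prob_finite_valued P (X := fun w => (columns w, signs w)) (fun k => G k.1 k.2) mX).
congr EFin; rewrite /pE big_mkcond sum_pair; apply: eq_bigr => b _.
rewrite /rE /pE mulr_sumr; apply: eq_bigr => a _ /=.
by case: (G b a); rewrite ?prob_joint ?mulr0 //= mulr1.
Qed.

Lemma column_mass_ge0 j t : 0 <= column_mass j t.
Proof. by rewrite fine_ge0. Qed.

Lemma column_mass_sum j (G : pred {ffun 'I_m -> bool}) :
  (\sum_(t | G t) column_mass j t)%:E = P [set w | G (columns w j)].
Proof.
rewrite -(prob_finite_valued P (X := fun w => columns w j)) //.
exact: measurable_column.
Qed.

Lemma column_mass_sum1 j : \sum_t column_mass j t = 1.
Proof.
apply: EFin_inj; rewrite (column_mass_sum j xpredT) -(probability_setT P).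
by congr (P _); apply/seteqP; split.
Qed.

(** A value of nonzero mass is attained at some outcome, where the pointwise column sum applies. *)
Lemma column_mass_weight j t : column_mass j t != 0 -> (\sum_i t i)%N = s.
Proof.
move=> qt; have [w wt] : exists w, columns w j = t.
  apply: contrapT => no; move/eqP: qt; apply; rewrite /column_mass.
  rewrite (_ : [set w | _] = set0) ?measure0 //.
  by apply/seteqP; split => // w wt; apply: no; exists w.
apply/eqP; rewrite -(eqr_nat R) -(delta_column_sum H j w) natr_sum -wt.
by apply/eqP; apply: eq_bigr => i _; rewrite columnsE.
Qed.

Lemma column_mass_moment j (I : {set 'I_m}) :
  \sum_t column_mass j t * \prod_(i in I) (t i)%:R <= (s%:R / m%:R) ^+ #|I|.
Proof.
have prodE (t : {ffun 'I_m -> bool}) :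
    \prod_(i in I) (t i)%:R = ([forall i in I, t i])%:R :> R.
  case: (boolP [forall i in I, t i]) => [/forall_inP tI|].
    by rewrite big1 // => i /tI ->.
  by rewrite negb_forall_in => /exists_inP[i iI ti]; rewrite (bigD1 i) //= (negbTE ti) mul0r.
have -> : \sum_t column_mass j t * \prod_(i in I) (t i)%:R =
    \sum_(t : {ffun 'I_m -> bool} | [forall i in I, t i]) column_mass j t.
  rewrite [RHS]big_mkcond; apply: eq_bigr => t _; rewrite prodE.
  by case: ifP => _; rewrite ?mulr1 ?mulr0.
rewrite -lee_fin column_mass_sum; apply: le_trans (delta_moment H j I).
set A := [set w | _].
have mA : measurable A.
  have [|mA _] := @prob_mem_seq _ _ _ P _ (fun w => columns w j)
    (enum [pred t : {ffun 'I_m -> bool} | [forall i in I, t i]]) (measurable_column j).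
    exact: enum_uniq.
  by move: mA; congr measurable; apply/seteqP; split => w /=; rewrite mem_enum.
rewrite -(expectation_indic P mA) le_eqVlt; apply/orP; left; apply/eqP.
congr ('E_P[_])%E; apply: funext => w; rewrite indicE.
rewrite (eq_bigr (fun i => (columns w j i)%:R)) => [|i _]; last by rewrite columnsE.
by rewrite prodE; congr (nat_of_bool _)%:R; apply/idP/idP; rewrite inE.
Qed.

End Bridge.

(** * Least squares *)

Section Frame.
Variable R : realType.

Lemma nsq_eq0 n (x : 'cV[R]_n) : nsq x = 0 -> x = 0.
Proof.
move=> x0; apply/colP => i; rewrite mxE; apply/eqP; rewrite -sqrf_eq0; apply/eqP.
by apply: (psumr_eq0P _ x0) => // j _; exact: sqr_ge0.
Qed.

(** A row basis [V] of the transpose has Gram matrix with spectral data [Z] and [l]. As [V] is free,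
    [l] is positive, and scaling the rows of [Z *m V] by the inverse square roots of [l] makes them
    orthonormal. *)
Lemma orthonormal_column_frame n d (A : 'M[R]_(n, d)) :
  exists U : 'M[R]_(n, \rank A),
    [/\ U^T *m U = 1%:M, exists E, U = A *m E & U *m U^T *m A = A].
Proof.
rewrite -mxrank_tr.
have [V [Vfree VA]] : exists V : 'M[R]_(\rank A^T, n), row_free V /\ (V :=: A^T)%MS.
  by exists (row_base A^T); split; [exact: row_base_free|exact: eq_row_base].
pose G := V *m V^T.
have Gs : G^T = G by rewrite trmx_mul trmxK.
have [Z [l [ZZ GE]]] := sym_spectral Gs.
have ZtZ : Z^T *m Z = 1%:M by exact: mulmx1C.
have DE : diag_mx l = Z *m V *m (Z *m V)^T.
  rewrite trmx_mul mulmxA -(mulmxA Z) -/G GE !mulmxA ZZ mul1mx -mulmxA ZZ.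
  by rewrite mulmx1.
have l0 i : 0 < l 0 i.
  have li : l 0 i = nsq ((row i (Z *m V))^T).
    have /matrixP/(_ i i) := DE; rewrite mxE eqxx mulr1n => ->.
    by rewrite mxE; apply: eq_bigr => j _; rewrite !mxE expr2.
  rewrite li lt_def nsq_ge0 andbT; apply/eqP => /nsq_eq0 /(congr1 trmx).
  rewrite trmxK trmx0 row_mul => /eqP; rewrite mulmx_free_eq0 // => /eqP ri.
  have /matrixP/(_ 0 i) := congr1 (fun X => X *m Z^T) ri.
  rewrite -row_mul ZZ mul0mx !mxE eqxx => /eqP; by rewrite oner_eq0.
pose D : 'rV[R]_(\rank A^T) := \row_i (Num.sqrt (l 0 i))^-1.
pose Di : 'rV[R]_(\rank A^T) := \row_i Num.sqrt (l 0 i).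
pose Ut := diag_mx D *m Z *m V.
have VE : V = Z^T *m diag_mx Di *m Ut.
  have DD : diag_mx Di *m diag_mx D = 1%:M.
    apply/matrixP => i j; rewrite mul_diag_mx !mxE mulrnAr mulfV //.
    by rewrite gt_eqF // sqrtr_gt0.
  by rewrite /Ut !mulmxA -(mulmxA Z^T) DD mulmx1 ZtZ mul1mx.
have UtU : Ut *m Ut^T = 1%:M.
  have -> : Ut = diag_mx D *m (Z *m V) by rewrite /Ut [RHS]mulmxA.
  rewrite trmx_mul tr_diag_mx !mulmxA -(mulmxA (diag_mx D)) -(mulmxA (diag_mx D)) -DE.
  apply/matrixP => i j.
  rewrite mul_mx_diag mul_diag_mx !mxE; case: eqP => [->|_]; last by rewrite mulr0 mul0r.
  rewrite !mulr1n -{2}(sqr_sqrtr (ltW (l0 j))).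
  by field; rewrite gt_eqF // sqrtr_gt0.
exists Ut^T; rewrite trmxK; split => //.
  have /submxP[X XE] : (Ut <= A^T)%MS.
    by rewrite /Ut (submx_trans (submxMl _ _)) // VA.
  by exists X^T; rewrite XE trmx_mul trmxK.
have /submxP[Y YE] : (A^T <= V)%MS by rewrite VA.
have AE : Ut^T *m (Y *m (Z^T *m diag_mx Di))^T = A.
  by rewrite -trmx_mul -mulmxA -VE -YE trmxK.
clearbody Ut; rewrite -[X in _ *m X]AE -[RHS]AE mulmxA -[_ *m Ut^T]mulmxA.
by rewrite UtU mulmx1.
Qed.

(** The identity splits as [Q + (1%:M - Q)] with rows in [<<A^T>>] and [kermx A], two spaces that
    meet trivially. *)
Lemma col_proj_frame n d r (A : 'M[R]_(n, d)) (U : 'M[R]_(n, r)) :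
  (exists E, U = A *m E) -> U *m U^T *m A = A -> col_proj A = U *m U^T.
Proof.
move=> [E UE] UA; set Q := U *m U^T.
have dis : (<<A^T>> :&: kermx A = 0)%MS.
  apply/eqP; rewrite -submx0; apply/rV_subP => v; rewrite sub_capmx genmxE.
  case/andP => /submxP[x vx] /sub_kermxP vA.
  have vv : v *m v^T = 0 by rewrite {2}vx trmx_mul trmxK mulmxA vA mul0mx.
  have v0 : v^T = 0 by apply: nsq_eq0; rewrite nsqE trmxK vv mxE.
  by rewrite -[v]trmxK v0 trmx0 sub0mx.
have Q1 : (Q <= <<A^T>>)%MS.
  by rewrite genmxE /Q [in U^T]UE trmx_mul mulmxA submxMl.
have Q2 : (1%:M - Q <= kermx A)%MS.
  by apply/sub_kermxP; rewrite mulmxBl mul1mx UA subrr.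
rewrite -[LHS]mul1mx -[1%:M](subrK Q) mulmxDl /col_proj.
by rewrite proj_mx_0 // add0r proj_mx_id.
Qed.

Lemma norm2_sqr p q (v : 'M[R]_(p, q)) : norm2 v ^+ 2 = \sum_i \sum_j v i j ^+ 2.
Proof.
rewrite sqr_sqrtr //; apply: sumr_ge0 => i _; apply: sumr_ge0 => j _.
exact: sqr_ge0.
Qed.

Lemma norm2_sqr_col n (x : 'cV[R]_n) : norm2 x ^+ 2 = nsq x.
Proof. by rewrite norm2_sqr; apply: eq_bigr => i _; rewrite big_ord1. Qed.

Lemma coherence_ge0 n d (A : 'M[R]_(n, d)) : 0 <= coherence A.
Proof.
rewrite /coherence; elim/big_ind: _ => // [x y x0 y0|j _]; last exact: sqrtr_ge0.
by rewrite le_max x0.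
Qed.

(** Orthonormal columns preserve lengths, so the [j]-th row of [U] is as long as the projected basis
    vector. *)
Lemma frame_row_le_coherence n d r (A : 'M[R]_(n, d)) (U : 'M[R]_(n, r)) j :
  U^T *m U = 1%:M -> col_proj A = U *m U^T ->
  nsq (row j U)^T <= coherence A ^+ 2.
Proof.
move=> UU AU; have -> : nsq (row j U)^T = norm2 (delta_mx (0 : 'I_1) j *m col_proj A) ^+ 2.
  rewrite AU mulmxA -rowE norm2_sqr big_ord1.
  have -> : \sum_j0 (row j U *m U^T) 0 j0 ^+ 2 = nsq (row j U *m U^T)^T.
    by apply: eq_bigr => k _; rewrite [in RHS]mxE.
  by rewrite !nsqE !trmxK trmx_mul trmxK mulmxA -(mulmxA _ U^T) UU mulmx1.
rewrite lerXn2r ?nnegrE ?coherence_ge0 ?sqrtr_ge0 //.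
by rewrite /coherence (bigD1 j) //= le_max lexx.
Qed.

Lemma quadratic_min (c k : R) : 0 <= k -> (forall t, 0 <= 2 * t * c + t ^+ 2 * k) -> c = 0.
Proof.
rewrite le0r => /predU1P[-> H|k0 H].
  by have := H 1; have := H (-1); rewrite !mulr0 !addr0; lra.
have := H (- (c / k)).
have -> : 2 * - (c / k) * c + (- (c / k)) ^+ 2 * k = - (c ^+ 2 / k) by field; rewrite gt_eqF.
rewrite oppr_ge0 pmulr_lle0 ?invr_gt0 // => c2.
by apply/eqP; rewrite -sqrf_eq0 eq_le c2 sqr_ge0.
Qed.

(** Moving along the gradient direction [y] changes the objective by [2 * t * nsq y] plus a
    nonnegative quadratic term, so minimality forces [nsq y = 0]. *)
Lemma normal_equations n d (A : 'M[R]_(n, d)) b x :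
  minimizer (lsq A b) x -> A^T *m (A *m x - b) = 0.
Proof.
move=> xmin; set v := A *m x - b; set y := A^T *m v.
apply: nsq_eq0; apply: (@quadratic_min _ (nsq (A *m y))); first exact: nsq_ge0.
move=> t; have := xmin (x + t *: y).
have -> : lsq A b (x + t *: y) = nsq (v + t *: (A *m y)).
  by rewrite /lsq norm2_sqr_col [A *m (x + _)]mulmxDr -[A *m (t *: y)]scalemxAr addrAC.
rewrite /lsq norm2_sqr_col -/v (nsqD v (t *: _)) nsqZ ipZr.
have -> : ip v (A *m y) = nsq y.
  by rewrite ipE nsqE mulmxA {2}/y -[v^T *m A]trmxK trmx_mul trmxK.
by lra.
Qed.

(* With [V := Phi U] and [v := U^T A (xhat - xstar)] the two normal equations
   give [V^T V v = V^T Phi z]. *)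
Theorem sketched_lsq n d r m (A : 'M[R]_(n, d)) b (U : 'M[R]_(n, r))
  (F : 'M[R]_(m, n)) xstar xhat e :
  U^T *m U = 1%:M -> (exists E, U = A *m E) -> U *m U^T *m A = A ->
  0 < e -> e < 2^-1 ->
  minimizer (lsq A b) xstar -> minimizer (lsq (F *m A) (F *m b)) xhat ->
  (forall x, 4^-1 * nsq x <= nsq (F *m U *m x)) ->
  nsq ((F *m U)^T *m (F *m (b - A *m xstar))) <= e / 8 * nsq (b - A *m xstar) ->
  lsq A b xhat <= (1 - e) ^- 2 * lsq A b xstar.
Proof.
move=> UU [E UE] UA e0 e2 /normal_equations star /normal_equations hat lower crossb.
set z := b - A *m xstar in crossb *; set V := F *m U in lower crossb *.
pose v := U^T *m (A *m (xhat - xstar)); pose w := V^T *m (F *m z).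
have Uv : U *m v = A *m (xhat - xstar) by rewrite /v !mulmxA UA.
have res : A *m xhat - b = U *m v - z.
  by rewrite Uv mulmxBr /z opprB addrA subrK.
have Uz : U^T *m z = 0.
  have -> : z = - (A *m xstar - b) by rewrite opprB.
  by rewrite UE trmx_mul -mulmxA mulmxN star oppr0 mulmx0.
have hatV : V^T *m (V *m v) = w.
  have : E^T *m ((F *m A)^T *m (F *m A *m xhat - F *m b)) = 0 by rewrite hat mulmx0.
  rewrite mulmxA -trmx_mul -[F *m A *m E]mulmxA -UE -/V -mulmxA -mulmxBr res.
  rewrite mulmxBr [F *m (U *m v)]mulmxA -/V mulmxBr => /eqP.
  by rewrite subr_eq0 => /eqP.
have vw : nsq (V *m v) = ip v w.
  by rewrite nsqE ipE -hatV trmx_mul !mulmxA.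
have nsq_zv : nsq (U *m v - z) = nsq v + nsq z.
  rewrite nsqD nsqN -[- z]scaleN1r ipZr ipE trmx_mul -mulmxA Uz mulmx0 mxE.
  rewrite !mulr0 addr0; congr (_ + _).
  by rewrite !nsqE trmx_mul mulmxA -(mulmxA v^T) UU mulmx1.
(* Energy and Cauchy-Schwarz: |v|^2 / 4 <= <v, w> <= |v| |w|, hence |v| <= 4 |w|. *)
have v16 : nsq v <= 16 * nsq w.
  have := lower v; rewrite vw => H1.
  have := ip_sqr_le v w; have := nsq_ge0 v; have := nsq_ge0 w.
  set a := nsq v in H1 *; set c := nsq w; set i := ip v w in H1 * => c0 a0 H2.
  move: a0; rewrite le0r => /predU1P[->|a0]; first by rewrite mulr_ge0.
  have H3 : (4^-1 * a) ^+ 2 <= a * c.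
    apply: le_trans H2; rewrite lerXn2r ?nnegrE //; first by rewrite mulr_ge0 // ltW.
    by apply: le_trans H1; rewrite mulr_ge0 // ltW.
  rewrite -(ler_pM2l a0); move: H3; rewrite exprMn expr2 expr2; lra.
have z0 := nsq_ge0 z.
rewrite /lsq !norm2_sqr_col res nsq_zv.
have -> : nsq (A *m xstar - b) = nsq z by rewrite -nsqN opprB.
have vz : nsq v <= 2 * e * nsq z by have := crossb; rewrite -/w; lra.
have e1 : 0 < (1 - e) ^+ 2 by rewrite exprn_gt0 // subr_gt0; lra.
rewrite mulrC ler_pdivlMr //.
have vz0 := nsq_ge0 v.
apply: le_trans (_ : (2 * e * nsq z + nsq z) * (1 - e) ^+ 2 <= _).
  by rewrite ler_wpM2r ?(ltW e1) // lerD2r.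
(* The factor [1 + 2 * e] fits because [(1 + 2 * e) * (1 - e) ^+ 2 = 1 - e ^+ 2 * (3 - 2 * e)]. *)
have -> : (2 * e * nsq z + nsq z) * (1 - e) ^+ 2 = nsq z - nsq z * (e ^+ 2 * (3 - 2 * e)) by ring.
rewrite gerBl mulr_ge0 // mulr_ge0 ?sqr_ge0 //; lra.
Qed.

End Frame.

(** * The sketch as a matrix *)

Section SketchMatrix.
Variables (R : realType) (m n r s : nat) (U : 'M[R]_(n, r)) (zv : 'cV[R]_n).
Variables (b : {ffun 'I_n -> {ffun 'I_m -> bool}}) (a : {ffun 'I_m * 'I_n -> bool}).

Definition sketch_mx : 'M[R]_(m, n) :=
  \matrix_(i, j) ((Num.sqrt s%:R)^-1 * sgb R (a (i, j)) * (b j i)%:R).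

Let u j := (row j U)^T.

Lemma sketch_rowE i : sketch_row s u b (row_of a i) i = (row i (sketch_mx *m U))^T.
Proof.
apply/colP => k; rewrite summxE !mxE; apply: eq_bigr => j _.
by rewrite !mxE ffunE; ring.
Qed.

Lemma sketch_coordE i :
  sketch_coord s (fun j => zv j 0) b (row_of a i) i = (sketch_mx *m zv) i 0.
Proof. by rewrite mxE; apply: eq_bigr => k _; rewrite mxE ffunE; ring. Qed.

Lemma sketch_energy x :
  \sum_i ip (sketch_row s u b (row_of a i) i) x ^+ 2 = nsq (sketch_mx *m U *m x).
Proof.
apply: eq_bigr => i _; congr (_ ^+ _); rewrite sketch_rowE mxE.
by apply: eq_bigr => k _; rewrite mxE mxE.
Qed.

Lemma crossE : cross s u (fun j => zv j 0) b a =
  (sketch_mx *m U)^T *m (sketch_mx *m zv).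
Proof.
apply/colP => k; rewrite summxE [RHS]mxE; apply: eq_bigr => i _.
by rewrite mxE sketch_coordE sketch_rowE mulrC !mxE.
Qed.

End SketchMatrix.

Lemma frame_sum_rows (R : realType) n r (U : 'M[R]_(n, r)) : U^T *m U = 1%:M ->
  \sum_j (row j U)^T *m ((row j U)^T)^T = 1%:M.
Proof.
move=> UU; rewrite -UU; apply/matrixP => i k; rewrite summxE mxE.
by apply: eq_bigr => j _; rewrite mxE big_ord1 !mxE.
Qed.

Lemma frame_comb_rows (R : realType) n r (U : 'M[R]_(n, r)) (z : 'cV[R]_n) :
  \sum_j z j 0 *: (row j U)^T = U^T *m z.
Proof.
apply/colP => i; rewrite summxE mxE; apply: eq_bigr => j _.
by rewrite !mxE mulrC.
Qed.

Lemma powR_three_halves_sqr (R : realType) (x : R) : 0 <= x ->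
  (x `^ (3 / 2)) ^+ 2 = x ^+ 3.
Proof.
move=> x0; rewrite -powR_mulrn ?powR_ge0 // -powRrM.
have -> : 3 / 2 * 2%:R = 3%:R :> R by field.
by rewrite powR_mulrn.
Qed.

Local Open Scope classical_set_scope.
Local Open Scope ring_scope.

(* The constant C implements both occurrences of >~; being quantified first,
   it depends on nothing else. The event asks that every minimizer of the
   sketched problem be good. The restriction 1 < m is needed: for m = 1 the
   factors ln m vanish, eta may tend to 1, and the claim fails for m = s = 1,
   n = 2, A = e_1, b = e_2, eps = 1/4, where the bound has probability 0. *)
Theorem theorem6p4 (R : realType) :
  exists C : R, 0 < C /\
  forall (n d m s : nat) (A : 'M[R]_(n, d)) (b : 'cV[R]_n)
    (disp : measure_display) (Omega : measurableType disp)
    (P : probability Omega R) (Phi : Omega -> 'M[R]_(m, n))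
    (xstar : 'cV[R]_d) (eps eta : R),
  (1 < m)%N -> (0 < s)%N ->
  is_sjlt P s Phi ->
  minimizer (lsq A b) xstar ->
  0 < eps -> eps < 2^-1 ->
  0 < eta -> eta <= m%:R^-1 ->
  m%:R >= C * (eps^-1 *
    (ln (eta^-1) * ((\rank A)%:R + ln m%:R) * ln m%:R ^+ 2
     + ln (eta^-1) ^+ 2 * (\rank A)%:R)) ->
  s%:R >= C * (eps^-1 * coherence A ^+ 2 *
      (ln (eta^-1) ^+ 2 + ln (eta^-1) * ln m%:R ^+ 3)
    + (Num.sqrt eps)^-1 * coherence A *
      (ln (eta^-1) `^ (3 / 2) + ln (eta^-1) * ln m%:R `^ (3 / 2))) ->
  (P [set w | forall xhat : 'cV[R]_d,
        minimizer (lsq (Phi w *m A) (Phi w *m b)) xhat ->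
        (lsq A b xhat <= (1 - eps) ^- 2 * lsq A b xstar)%R]
    >= (1 - eta)%:E)%E.
Proof.
exists (10 ^+ 7); split; first by rewrite exprn_gt0 // ltr0n.
move=> n d m s A b disp Omega P Phi xstar e eta m1 s0 [sigma [delta [H PhiE]]] xmin.
move=> e0 e2 eta0 etam Hm Hs.
have C0 : 0 < 10 ^+ 7 :> R by rewrite exprn_gt0 // ltr0n.
have C1 : 1 <= 10 ^+ 7 :> R by rewrite exprn_ege1 // ler1n.
set L := ln eta^-1 in Hm Hs; set M := coherence A in Hs.
have eL : expR L = eta^-1 by rewrite lnK // posrE invr_gt0.
have m0 : 0 < m%:R :> R by rewrite ltr0n ltnW.
have mL : m%:R <= expR L by rewrite eL -[m%:R]invrK lef_pV2 // posrE invr_gt0.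
have L2 : 2 <= expR L by apply: le_trans mL; rewrite ler_nat.
have L0 : 0 <= L.
  rewrite -ler_expR expR0; apply: le_trans L2; by rewrite ler1n.
have lm0 : 0 <= ln m%:R :> R by apply: ln_ge0; rewrite ler1n ltnW.
have M0 : 0 <= M by exact: coherence_ge0.
have [U [UU UE UA]] := orthonormal_column_frame A.
pose u j := (row j U)^T; pose z := b - A *m xstar.
have Uz : U^T *m z = 0.
  have [E ->] := UE; rewrite trmx_mul -mulmxA.
  have -> : z = - (A *m xstar - b) by rewrite opprB.
  by rewrite mulmxN (normal_equations xmin) oppr0 mulmx0.
pose q := column_mass delta.
have q0 j t : 0 <= q j t by exact: column_mass_ge0.
have q1 j : \sum_t q j t = 1 by exact: (column_mass_sum1 H).
pose good (bb : {ffun 'I_n -> {ffun 'I_m -> bool}}) (aa : {ffun 'I_m * 'I_n -> bool}) :=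
  `[< forall xhat : 'cV[R]_d,
  minimizer (lsq (sketch_mx R s bb aa *m A) (sketch_mx R s bb aa *m b)) xhat ->
  lsq A b xhat <= (1 - e) ^- 2 * lsq A b xstar >].
have goodP bb aa : (forall x, 4^-1 * nsq x <= nsq (sketch_mx R s bb aa *m U *m x)) ->
    nsq ((sketch_mx R s bb aa *m U)^T *m (sketch_mx R s bb aa *m z)) <= e / 8 * nsq z ->
    good bb aa.
  move=> H1 H2; apply/asboolP => xhat xh.
  exact: (sketched_lsq UU UE UA e0 e2 xmin xh H1 H2).
have PhiS w : Phi w = sketch_mx R s (columns delta w) (signs sigma w).
  apply/matrixP => i j; rewrite PhiE mxE; congr (_ * _ * _).
    exact: (signsE H).
  exact: (columnsE H).
have -> : [set w | forall xhat : 'cV[R]_d,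
      minimizer (lsq (Phi w *m A) (Phi w *m b)) xhat ->
      lsq A b xhat <= (1 - e) ^- 2 * lsq A b xstar] =
    [set w | good (columns delta w) (signs sigma w)].
  by apply/seteqP; split=> w /=; rewrite PhiS => /asboolP.
rewrite (prob_sketch_event H) lee_fin -/q.
have h0 := @half_ge0 R ('I_m * 'I_n)%type.
have h1 := @half_sum1 R ('I_m * 'I_n)%type.
(* In rank 0 the frame space is trivial and every outcome is good. Positive rank guarantees a
   positive coherence, by which the row-mass bound divides. *)
have [r0|r0] := posnP (\rank A).
  have nsq0 (x : 'cV[R]_(\rank A)) : nsq x = 0.
    by rewrite /nsq big1 // => i; have := ltn_ord i; rewrite {2}r0.
  have all_good bb aa : good bb aa.
    apply: goodP => [x|]; first by rewrite nsq0 mulr0 nsq_ge0.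
    by rewrite nsq0 mulr_ge0 ?nsq_ge0 // divr_ge0 // ltW.
  rewrite (@eq_pE _ _ _ _ _ (fun=> 1)) ?pE_cst // ?gerBl ?(ltW eta0) // => bb.
  rewrite -[RHS](pE_cst h1); apply: eq_pE => aa.
  by rewrite all_good.
have uM j : nsq (u j) <= M ^+ 2.
  exact: frame_row_le_coherence UU (col_proj_frame UE UA).
have fr : \sum_j u j *m (u j)^T = 1%:M by exact: frame_sum_rows.
have M2 : 0 < M ^+ 2.
  rewrite lt_def sqr_ge0 andbT; apply/eqP => M20.
  have : (\rank A)%:R = 0 :> R.
    rewrite -(sum_nsq_frame fr) big1 // => j _; apply/eqP.
    by rewrite eq_le nsq_ge0 andbT -M20.
  by move/eqP; rewrite pnatr_eq0 -[_ == _]negbK -lt0n r0.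
have uz : \sum_j z j 0 *: u j = 0 by rewrite frame_comb_rows.
have rk0 : 0 <= (\rank A)%:R :> R by [].
have ei0 : 0 < e^-1 by rewrite invr_gt0.
have Hm' : 10 ^+ 7 * (L ^+ 2 * (\rank A)%:R) <= e * m%:R.
  rewrite -ler_pdivrMl //; apply: le_trans Hm; rewrite mulrCA ler_pM2l //.
  rewrite ler_pM2l // lerDr; apply: mulr_ge0; last exact: sqr_ge0.
  by apply: mulr_ge0 => //; apply: addr_ge0.
have Hs1 : 10 ^+ 7 * (M ^+ 2 * L ^+ 2) <= e * s%:R.
  rewrite -ler_pdivrMl //; apply: le_trans Hs; rewrite mulrCA ler_pM2l //.
  rewrite mulrA -[leLHS]addr0; apply: lerD.
    rewrite ler_wpM2l ?mulr_ge0 ?sqr_ge0 ?(ltW ei0) // lerDl.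
    by apply: mulr_ge0 => //; apply: exprn_ge0.
  apply: mulr_ge0; first by apply: mulr_ge0 => //; rewrite invr_ge0 sqrtr_ge0.
  by apply: addr_ge0; rewrite ?powR_ge0 // mulr_ge0 // powR_ge0.
(* Squaring the second half of the sparsity condition turns the power 3/2 into a cube and the
   inverse root of [e] into [e^-1]; the squared constant is only larger. *)
have Hs2 : 10 ^+ 7 * (M ^+ 2 * L ^+ 3) <= e * s%:R ^+ 2.
  have se0 : 0 < Num.sqrt e by rewrite sqrtr_gt0.
  set c := 10 ^+ 7 in C0 C1 Hs *; clearbody c.
  have K0 : 0 <= c * ((Num.sqrt e)^-1 * M * L `^ (3 / 2)).
    apply: mulr_ge0; first exact: ltW.
    by apply: mulr_ge0 (powR_ge0 _ _); rewrite mulr_ge0 // invr_ge0 ltW.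
  have K1 : c * ((Num.sqrt e)^-1 * M * L `^ (3 / 2)) <= s%:R.
    apply: le_trans Hs; rewrite ler_pM2l // -[leLHS]add0r; apply: lerD.
      apply: mulr_ge0; first by rewrite mulr_ge0 ?sqr_ge0 // ltW.
      by apply: addr_ge0; rewrite ?sqr_ge0 // mulr_ge0 // exprn_ge0.
    rewrite ler_wpM2l ?lerDl ?mulr_ge0 ?powR_ge0 // invr_ge0 ltW //.
  have : (c * ((Num.sqrt e)^-1 * M * L `^ (3 / 2))) ^+ 2 <= s%:R ^+ 2.
    by rewrite lerXn2r ?nnegrE.
  rewrite !exprMn powR_three_halves_sqr // exprVn sqr_sqrtr ?(ltW e0) // => K2.
  rewrite -ler_pdivrMl //; apply: le_trans K2.
  have X0 : 0 <= e^-1 * (M ^+ 2 * L ^+ 3).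
    by apply: mulr_ge0; [exact: ltW|apply: mulr_ge0; [exact: sqr_ge0|exact: exprn_ge0]].
  have cc : c <= c ^+ 2 by rewrite expr2 -[leLHS]mulr1 ler_wpM2l // ltW.
  apply: le_trans (_ : c * (e^-1 * (M ^+ 2 * L ^+ 3)) <= _); first by rewrite mulrCA.
  apply: le_trans (ler_wpM2r X0 cc) _.
  by rewrite -[e^-1 * M ^+ 2 * _]mulrA.
have fail := sketch_fail_prob q0 q1 (column_mass_weight H) (column_mass_moment H)
  fr uz (ltnW m1) s0 uM M2 e0 (ltW e2) L2 mL Hm' Hs1 Hs2.
have etaE : eta = expR (- L) by rewrite expRN eL invrK.
pose bad (bb : {ffun 'I_n -> {ffun 'I_m -> bool}}) (aa : {ffun 'I_m * 'I_n -> bool}) :=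
  lower_fail s u bb aa || cross_fail s u (fun j => z j 0) e bb aa.
(* Passage to the complement: outside [bad], both hypotheses of [goodP] hold. *)
apply: le_trans (_ : pE q (fun bb => 1 + -1 * rE (fun aa => (bad bb aa)%:R)) <= _).
  by rewrite pED pE_cst // pEZ mulN1r lerD2l lerN2 etaE.
apply: (pE_mono q0) => bb.
rewrite -{1}(pE_cst h1 1) /rE -pEZ -pED; apply: (pE_mono h0) => aa.
rewrite /bad; case: (boolP (lower_fail _ _ _ _)) => [_|/asboolPn lf] /=.
  by rewrite mulN1r subrr.
case: (boolP (cross_fail _ _ _ _ _ _)) => [_|cf] /=; first by rewrite mulN1r subrr.
rewrite mulr0 addr0 goodP //.
  move=> x; rewrite -sketch_energy leNgt; apply/negP => xl; apply: lf.
  by exists x.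
move: cf; rewrite /cross_fail -leNgt crossE; congr (_ <= _ * _).
Qed.
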